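(* Let $X=\ell_p(\mathbb Z)$ with $p\in[1,+\infty)$, or $X=c_0(\mathbb Z)$. Let $w=(w_n)_{n\in\mathbb Z}$ be a sequence of positive real numbers that is bounded and bounded below (i.e. $0<\inf_{n}w_n\le \sup_n w_n<+\infty$), and let $B_w:X\to X$ be the associated bilateral weighted shift. Then $B_w$ is strongly structurally stable if and only if one of the following conditions holds: (A) $\lim_{n\to+\infty}\ \sup_{k\in\mathbb Z}\,(w_k w_{k+1}\cdots w_{k+n})^{1/n}<1$; (B) $\lim_{n\to+\infty}\ \inf_{k\in\mathbb Z}\,(w_k w_{k+1}\cdots w_{k+n})^{1/n}>1$; (C) $\lim_{n\to+\infty}\ \sup_{k\in\mathbb N}\,(w_{-k}w_{-k-1}\cdots w_{-k-n})^{1/n}<1$ and $\lim_{n\to+\infty}\ \inf_{k\in\mathbb N}\,(w_k w_{k+1}\cdots w_{k+n})^{1/n}>1$.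
   Context: $\mathbb N=\{1,2,3,\dots\}$. The spaces $\ell_p(\mathbb Z)$ and $c_0(\mathbb Z)$ are the usual complex Banach spaces of sequences indexed by $\mathbb Z$. The bilateral weighted shift is $B_w\big((x_n)_{n\in\mathbb Z}\big)=(w_{n+1}x_{n+1})_{n\in\mathbb Z}$; since $w$ is bounded and bounded below by a positive constant, it is a bounded invertible operator on $X$. For a map $\alpha:X\to X$, $\|\alpha\|_\infty=\sup_{x\in X}\|\alpha(x)\|$ and, if $\alpha$ is Lipschitz, $\mathrm{Lip}(\alpha)$ denotes its (best) Lipschitz constant; $\mathrm{Lip}(X)$ is the set of Lipschitz maps from $X$ to $X$. A bounded operator $T$ on a complex Banach space $X$ is strongly structurally stable if for every $\varepsilon>0$ there exists $\delta>0$ such that, for any $\alpha\in\mathrm{Lip}(X)$ with $\|\alpha\|_\infty\le\delta$ and $\mathrm{Lip}(\alpha)\le\delta$, there is a map $\varphi:X\to X$ with $\|\varphi\|_\infty\le\varepsilon$ such that $I+\varphi$ is a homeomorphism of $X$ onto $X$ and $T\circ(I+\varphi)=(I+\varphi)\circ(T+\alpha)$, where $I$ is the identity map. *)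

(* Defs.v *)
From HB Require Import structures.
From mathcomp Require Import all_boot all_order all_algebra.
From mathcomp Require Import all_classical all_reals all_analysis.
From mathcomp Require Import complex zify.

Set Implicit Arguments.
Unset Strict Implicit.
Unset Printing Implicit Defensive.

Import Order.TTheory GRing.Theory Num.Theory.
Import numFieldNormedType.Exports.

Local Open Scope classical_set_scope.
Local Open Scope ring_scope.
Local Open Scope complex_scope.

(* The norm of a normed space over R[i] takes its values in R[i]; rnorm is the
   same norm with values in R. *)
Definition rnorm (R : realType) (X : normedZmodType R[i]) (v : X) : R :=
  complex.Re `|v|.

Section RealNorm.
Variables (R : realType) (X : normedZmodType R[i]).
Implicit Types u v : X.

Lemma rnormE v : (rnorm v)%:C = `|v|.
Proof. by rewrite /rnorm RRe_real// normr_real. Qed.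

Lemma rnorm_ge0 v : 0 <= rnorm v.
Proof. by rewrite -ler0c rnormE. Qed.

Lemma rnorm0 : rnorm (0 : X) = 0.
Proof. by rewrite /rnorm normr0. Qed.

Lemma rnorm_eq0 v : rnorm v = 0 -> v = 0.
Proof. by move=> v0; apply: normr0_eq0; rewrite -rnormE v0. Qed.

Lemma rnormD u v : rnorm (u + v) <= rnorm u + rnorm v.
Proof. by rewrite -lecR rmorphD/= !rnormE; apply: ler_normD. Qed.

Lemma rnormN v : rnorm (- v) = rnorm v.
Proof. by rewrite /rnorm normrN. Qed.

Lemma rnormB u v : rnorm (u - v) = rnorm (v - u).
Proof. by rewrite -rnormN opprB. Qed.
End RealNorm.

Lemma rnormM (R : realType) (a b : R[i]) : rnorm (a * b) = rnorm a * rnorm b.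
Proof. by apply: complexI; rewrite rmorphM/= !rnormE normrM. Qed.

Lemma rnorm_real (R : realType) (a : R) : rnorm (a%:C : R[i]) = `|a|.
Proof. by rewrite /rnorm normc_def/= expr0n addr0 sqrtr_sqr. Qed.

Lemma Re_le_rnorm (R : realType) (a : R[i]) : `|complex.Re a| <= rnorm a.
Proof.
by rewrite /rnorm normc_def/= -sqrtr_sqr ler_wsqrtr// lerDl sqr_ge0.
Qed.

Lemma Im_le_rnorm (R : realType) (a : R[i]) : `|complex.Im a| <= rnorm a.
Proof.
by rewrite /rnorm normc_def/= -sqrtr_sqr ler_wsqrtr// lerDr sqr_ge0.
Qed.

Lemma rnorm_le_ReIm (R : realType) (a : R[i]) : rnorm a <= `|complex.Re a| + `|complex.Im a|.
Proof.
rewrite /rnorm normc_def/= -[leRHS]ger0_norm ?addr_ge0// -sqrtr_sqr.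
rewrite ler_wsqrtr// sqrrD !real_normK ?num_real// lerD2r lerDl.
by rewrite mulrn_wge0// mulr_ge0.
Qed.

Section PowerSums.
Variables (R : realType) (p : R) (p1 : 1 <= p).
Local Open Scope ereal_scope.

Definition psum (f : int -> R) : \bar R :=
  \esum_(n in [set: int]) (f n `^ p)%:E.

Let p_gt0 : (0 < p)%R. Proof. exact: lt_le_trans p1. Qed.

Let pN0 : (p != 0)%R. Proof. by rewrite gt_eqF. Qed.

Let pV_ge0 : (0 <= p^-1)%R. Proof. by rewrite invr_ge0 ltW. Qed.

Lemma psum_ge0 f : 0 <= psum f.
Proof. by apply: esum_ge0 => n _; rewrite lee_fin powR_ge0. Qed.

Lemma psum_le f g : (forall n, (0 <= f n <= g n)%R) -> psum f <= psum g.
Proof.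
move=> fg; apply: le_esum => n _; have /andP[f0 h] := fg n.
by rewrite lee_fin ge0_ler_powR ?(ltW p_gt0)// nnegrE (le_trans f0 h).
Qed.

Let enum_int (n : nat) : int := if odd n then Negz n./2 else Posz n./2.

Let rank_int (z : int) : nat :=
  match z with Posz n => n.*2 | Negz n => n.*2.+1 end.

Let enum_int_bij : set_bij [set: nat] [set: int] enum_int.
Proof.
split => //.
- apply: in2W; apply: (can_inj (g := rank_int)) => n.
  rewrite /enum_int -[RHS]odd_double_half.
  by case: (odd n).
- move=> z _; exists (rank_int z) => //; case: z => n;
    by rewrite /enum_int /= odd_double/= ?doubleK ?uphalf_double.
Qed.

Let psumE f : psum f = \sum_(0 <= n <oo) (f (enum_int n) `^ p)%:E.
Proof.
rewrite /psum (reindex_esum _ _ _ _ enum_int_bij) -nneseries_esumT//.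
by move=> n; rewrite lee_fin powR_ge0.
Qed.

Lemma psumZ (a : R) f : (0 <= a)%R -> (forall n, 0 <= f n)%R ->
  psum (fun n => a * f n)%R = (a `^ p)%:E * psum f.
Proof.
move=> a0 f0; rewrite !psumE -nneseriesZl; last first.
  by move=> n _; rewrite lee_fin powR_ge0.
by apply: eq_eseriesr => n _; rewrite powRM.
Qed.

Lemma minkowski_psum f g : (forall n, 0 <= f n)%R -> (forall n, 0 <= g n)%R ->
  psum (fun n => f n + g n)%R `^ p^-1 <= psum f `^ p^-1 + psum g `^ p^-1.
Proof.
move=> f0 g0.
have LE h : (forall n, 0 <= h n)%R ->
    'N[counting]_p%:E[EFin \o (h \o enum_int)] = psum h `^ p^-1.
  move=> h0; rewrite Lnorm_counting// psumE; congr (_ `^ _).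
  by apply: eq_eseriesr => n _ /=; rewrite ger0_norm.
rewrite -!LE//; last by move=> n; rewrite addr_ge0.
exact: (@minkowski_EFin _ _ _ counting (f \o enum_int) (g \o enum_int)).
Qed.

Lemma psum_leE f (M : R) : (0 <= M)%R ->
  (psum f <= (M `^ p)%:E) = (psum f `^ p^-1 <= M%:E).
Proof.
move=> M0; have := psum_ge0 f; case: (psum f) => [r| |]; [|move=> _|by []]; last first.
  by rewrite poweRyr ?invr_eq0 ?gt_eqF.
rewrite poweR_EFin !lee_fin => r0; apply/idP/idP => h.
- rewrite -[leRHS](powRr1 M0) -(mulfV pN0) powRrM.
  by rewrite ge0_ler_powR ?nnegrE ?powR_ge0.
- rewrite -[leLHS](powRr1 r0) -(mulVf pN0) powRrM.
  by rewrite ge0_ler_powR ?nnegrE ?powR_ge0 ?(ltW p_gt0).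
Qed.

Lemma psum_limit (f : int -> R) (e : R) : (0 <= e)%R -> (forall n, 0 <= f n)%R ->
  (forall (A : seq int) (d : R), (0 < d)%R -> exists g : int -> R,
     [/\ forall n, (0 <= g n)%R, psum g <= (e `^ p)%:E &
         forall n, n \in A -> (f n <= d + g n)%R]) ->
  psum f <= (e `^ p)%:E.
Proof.
move=> e0 f0 lim; apply: ub_ereal_sup => _ [A [finA _] <-].
pose ind (n : int) : R := ((n \in A) : nat)%:R.
have ind0 n : (0 <= ind n)%R by rewrite ler0n.
pose c : R := (fine (psum ind) `^ p^-1)%R.
have c0 : (0 <= c)%R by rewrite powR_ge0.
have psum_ind (h : int -> R) : psum (fun n => ind n * h n)%R =
    \sum_(n \in A) (h n `^ p)%:E.
  rewrite -esum_fset//; last by move=> n _; rewrite lee_fin powR_ge0.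
  rewrite [RHS]esum_mkcond; apply: eq_esum => n _; rewrite /ind.
  by case: ifP => _; rewrite ?mul1r ?mul0r ?powR0// gt_eqF.
have ind_fin : psum ind \is a fin_num.
  have -> : ind = (fun n => ind n * 1)%R by apply/funext => n; rewrite mulr1.
  by rewrite psum_ind fsbig_finite// sumEFin.
have psum_indE : psum ind `^ p^-1 = c%:E.
  by rewrite /c -poweR_EFin fineK.
rewrite -psum_ind psum_leE//; apply/lee_addgt0Pr => d d0.
pose d' := (d / (c + 1))%R.
have d'0 : (0 < d')%R by rewrite divr_gt0// ltr_wpDl.
have [g [g0 ge fg]] := lim (finmap.enum_fset (fset_set A)) d' d'0.
apply: (@le_trans _ _ (psum (fun n => d' * ind n + g n)%R `^ p^-1)).
  have h0 : (0 <= d' * 1)%R by rewrite mulr1 ltW.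
  rewrite gt0_ler_poweR// ?in_itv/= ?psum_ge0 ?leey//.
  apply: psum_le => n; rewrite mulr_ge0//=.
  rewrite /ind; case: (boolP (n \in A)) => nA.
    by rewrite mul1r mulr1 fg// in_fset_set.
  by rewrite mul0r mulr0 add0r.
apply: le_trans (minkowski_psum _ _) _ => //.
  by move=> n; rewrite mulr_ge0// ltW.
rewrite addeC; apply: leeD; first by rewrite -psum_leE.
rewrite psumZ ?(ltW d'0)// poweRM ?psum_ge0 ?lee_fin ?powR_ge0//.
rewrite poweR_EFin -powRrM mulfV ?gt_eqF// powRr1 ?(ltW d'0)// psum_indE.
rewrite -EFinM lee_fin /d' mulrAC ler_pdivrMr ?ltr_wpDl//.
by rewrite ler_pM2l// lerDl.
Qed.

End PowerSums.

(* Completeness of a space of sequences with N s e meaning "the norm of the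
   sequence s is at most e". *)
Section SequenceSpaceComplete.
Variables (R : realType) (V : normedModType R[i]) (ev : V -> int -> R[i]).
Variable N : (int -> R[i]) -> R -> Prop.
Hypothesis N_norm : forall (u v : V) (e : R), 0 <= e ->
  rnorm (u - v) <= e <-> N (fun n => ev u n - ev v n) e.
Hypothesis N_coord : forall (u v : V) n,
  rnorm (ev u n - ev v n) <= rnorm (u - v).
Hypothesis N_lim : forall (F : set_system V) (y s : int -> R[i]) (e : R),
  ProperFilter F -> 0 <= e ->
  (forall n d, 0 < d -> \forall v \near F, rnorm (ev v n - y n) < d) ->
  (\forall v \near F, N (fun n => ev v n - s n) e) -> N (fun n => y n - s n) e.
Hypothesis N_closed : forall y : int -> R[i],
  (forall e, 0 < e -> exists u : V, N (fun n => y n - ev u n) e) ->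
  exists z : V, ev z = y.

Lemma sequence_space_complete (F : set_system V) :
  ProperFilter F -> cauchy F -> cvg F.
Proof.
move=> FF /cauchyP Fc.
have near_u (e : R) : 0 < e -> exists u : V, \forall v \near F, rnorm (v - u) < e.
  move=> e0; have [|u Fu] := Fc e%:C; first by rewrite ltcR.
  exists u; apply: filterS Fu => v; rewrite -ball_normE/= -rnormE ltcR.
  by rewrite rnormB.
have real_lim (f : R[i] -> R) n : (forall a b, `|f a - f b| <= rnorm (a - b)) ->
    exists c : R, forall d, 0 < d -> \forall v \near F, `|f (ev v n) - c| < d.
  move=> fle; have : cvg ((fun v => f (ev v n)) @ F).
    apply: R_complete; apply/cauchyP => d d0.
    have [u Fu] := near_u d d0; exists (f (ev u n)).
    rewrite /nbhs/=; apply: filterS Fu => v vu.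
    rewrite -ball_normE/= distrC.
    by apply: le_lt_trans vu; apply: le_trans (N_coord v u n).
  move=> /cvg_ex[c cl]; exists c => d d0.
  by move/cvgrPdistC_lt : cl => /(_ d d0).
have /choice[y yP] : forall n, exists c : R[i],
    forall d, 0 < d -> \forall v \near F, rnorm (ev v n - c) < d.
  move=> n.
  have [|a aP] := real_lim (@complex.Re R) n.
    by move=> x z; rewrite -raddfB Re_le_rnorm.
  have [|b bP] := real_lim (@complex.Im R) n.
    by move=> x z; rewrite -raddfB Im_le_rnorm.
  exists (a +i* b) => d d0.
  have d20 : 0 < d / 2 by rewrite divr_gt0.
  apply: filterS2 (aP _ d20) (bP _ d20) => v va vb.
  apply: le_lt_trans (rnorm_le_ReIm _) _.
  by rewrite !raddfB/= [d]splitr ltrD.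
have yu (e : R) u : 0 < e -> (\forall v \near F, rnorm (v - u) < e) ->
    N (fun n => y n - ev u n) e.
  move=> e0 Fu; apply: (N_lim FF (ltW e0) yP).
  by apply: filterS Fu => v vu; apply/N_norm; apply/ltW.
have [z zy] : exists z : V, ev z = y.
  by apply: N_closed => e e0; have [u Fu] := near_u e e0; exists u; apply: yu.
apply/cvg_ex; exists z; apply/cvgrPdist_lt => e e0.
have eE : e = (complex.Re e)%:C by rewrite RRe_real// gtr0_real.
move: e0; rewrite eE ltcR; move: (complex.Re e) => {eE}e e0.
have e20 : 0 < e / 2 by rewrite divr_gt0.
have [u Fu] := near_u _ e20.
have zu : rnorm (z - u) <= e / 2.
  by apply/N_norm; [exact: ltW|rewrite zy; exact: yu].
apply: filterS Fu => v vu; rewrite -rnormE ltcR [e]splitr.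
apply: le_lt_trans (_ : rnorm (z - u) + rnorm (v - u) < _).
  by rewrite -(rnormB u v) -{1}(subrK u z) -addrA rnormD.
by rewrite ler_ltD.
Qed.

End SequenceSpaceComplete.

Definition lp_sum (R : realType) (p : R) (x : int -> R[i]) : \bar R :=
  psum p (fun n => rnorm (x n)).

HB.lock Definition lp_norm (R : realType) (p : R) (x : int -> R[i]) : R :=
  fine (lp_sum p x) `^ p^-1.

Section LpSpace.
Variables (R : realType) (p : R).
Local Notation lp_sum := (lp_sum p).
Local Notation lp_norm := (lp_norm p).

Definition lp_pred & 1 <= p : {pred int -> R[i]} :=
  fun x => `[< (lp_sum x < +oo)%E >].

Variable p1 : 1 <= p.

Record lp_space := LpSeq {
  lp_val :> int -> R[i];
  _ : lp_val \in lp_pred p1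
}.

HB.instance Definition _ := [isSub for lp_val].
HB.instance Definition _ := [Choice of lp_space by <:].

Let p_gt0 : 0 < p. Proof. exact: lt_le_trans p1. Qed.

Lemma lp_predP x : reflect (lp_sum x < +oo)%E (x \in lp_pred p1).
Proof. exact: asboolP. Qed.

Lemma lp_sumZ (a : R[i]) x :
  lp_sum (fun n => a * x n) = ((rnorm a `^ p)%:E * lp_sum x)%E.
Proof.
rewrite -psumZ ?rnorm_ge0//; last by move=> n; rewrite rnorm_ge0.
by congr psum; apply/funext => n; rewrite rnormM.
Qed.

Lemma lp_sum_ge0 x : (0 <= lp_sum x)%E.
Proof. exact: psum_ge0. Qed.

Lemma lp_minkowski x y : (lp_sum (fun n => x n + y n)%R `^ p^-1 <=
  lp_sum x `^ p^-1 + lp_sum y `^ p^-1)%E.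
Proof.
apply: le_trans (minkowski_psum p1 _ _); last 2 first.
- by move=> n; rewrite rnorm_ge0.
- by move=> n; rewrite rnorm_ge0.
rewrite gt0_ler_poweR ?invr_ge0 ?(ltW p_gt0)// ?in_itv/= ?psum_ge0 ?leey//.
by apply: psum_le => // n; rewrite rnorm_ge0 rnormD.
Qed.

Lemma lp_sum0 : lp_sum (fun=> 0) = 0%E.
Proof.
rewrite /lp_sum /psum esum1// => n _.
by rewrite rnorm0 powR0// gt_eqF.
Qed.

Lemma lp_submod_closed : submod_closed (lp_pred p1).
Proof.
split; first by apply/lp_predP; rewrite lp_sum0.
move=> a x y /lp_predP xp /lp_predP yp; apply/lp_predP.
apply: (@lty_poweRy _ _ p^-1); first by rewrite invr_neq0 ?gt_eqF.
apply: le_lt_trans (lp_minkowski _ _) _; apply: lte_add_pinfty.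
  apply: poweR_lty; rewrite lp_sumZ lte_mul_pinfty// lee_fin powR_ge0//.
exact: poweR_lty.
Qed.

HB.instance Definition _ :=
  GRing.isSubmodClosed.Build _ _ (lp_pred p1) lp_submod_closed.
HB.instance Definition _ := [SubChoice_isSubLmodule of lp_space by <:].

Lemma lp_valP (x : lp_space) : (lp_sum x < +oo)%E.
Proof. by case: x => x /= /lp_predP. Qed.

Lemma lp_normE (x : int -> R[i]) : (lp_sum x < +oo)%E ->
  ((lp_norm x)%:E = lp_sum x `^ p^-1)%E.
Proof.
by move=> xp; rewrite lp_norm.unlock -poweR_EFin fineK// ge0_fin_numE ?lp_sum_ge0.
Qed.

Lemma lp_normD (x y : int -> R[i]) : (lp_sum x < +oo)%E -> (lp_sum y < +oo)%E ->
  (lp_sum (fun n => x n + y n)%R < +oo)%E ->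
  lp_norm (fun n => x n + y n) <= lp_norm x + lp_norm y.
Proof.
move=> xp yp xyp.
have aux (a b c : R) (A B C : \bar R) : (C <= A + B)%E ->
    a%:E = A -> b%:E = B -> c%:E = C -> c <= a + b.
  by move=> h aA bB cC; move: h; rewrite -aA -bB -cC -EFinD lee_fin.
exact: aux (lp_minkowski x y) (lp_normE xp) (lp_normE yp) (lp_normE xyp).
Qed.

Lemma lp_normZ (a : R[i]) (x : int -> R[i]) : (lp_sum x < +oo)%E ->
  (lp_sum (fun n => a * x n)%R < +oo)%E ->
  lp_norm (fun n => a * x n) = rnorm a * lp_norm x.
Proof.
move=> xp axp.
have aux (b c : R) (B C : \bar R) : (C = (rnorm a `^ p)%:E * B)%E ->
    (0 <= B)%E -> b%:E = (B `^ p^-1)%E -> c%:E = (C `^ p^-1)%E ->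
    c = rnorm a * b.
  move=> -> B0 bB cC; apply: EFin_inj; rewrite cC EFinM bB.
  rewrite poweRM ?lee_fin ?powR_ge0//.
  by rewrite poweR_EFin -powRrM mulfV ?gt_eqF// powRr1// rnorm_ge0.
exact: aux (lp_sumZ a x) (lp_sum_ge0 x) (lp_normE xp) (lp_normE axp).
Qed.

Let lpD (x y : lp_space) :
  (lp_norm (x + y)%R)%:C <= (lp_norm x)%:C + (lp_norm y)%:C :> R[i].
Proof.
have := lp_normD (lp_valP x) (lp_valP y) (lp_valP (x + y)).
by rewrite -lecR => h; apply: le_trans h _; rewrite rmorphD.
Qed.

Let lpZ (a : R[i]) (x : lp_space) :
  (lp_norm (a *: x)%R)%:C = `|a| * (lp_norm x)%:C :> R[i].
Proof.
have -> : lp_norm (a *: x)%R = rnorm a * lp_norm x.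
  exact: lp_normZ (lp_valP x) (lp_valP (a *: x)).
by rewrite rmorphM/= rnormE.
Qed.

Lemma lp_coord (x : int -> R[i]) n (e : R) : 0 <= e ->
  (lp_sum x <= (e `^ p)%:E)%E -> rnorm (x n) <= e.
Proof.
move=> e0 xe; have : ((rnorm (x n) `^ p)%:E <= (e `^ p)%:E)%E.
  apply: le_trans xe; apply: esum_ge; exists [set n].
    by split => //; exact: finite_set1.
  by rewrite fsbig_set1.
rewrite lee_fin => xne; rewrite leNgt; apply/negP => ex.
by move: xne; rewrite leNgt gt0_ltr_powR ?nnegrE ?rnorm_ge0.
Qed.

Let lp0 (x : lp_space) : (lp_norm x)%:C = 0 :> R[i] -> x = 0.
Proof.
move=> /complexI x0; apply: val_inj; apply/funext => n /=; apply: rnorm_eq0.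
apply/eqP; rewrite eq_le rnorm_ge0 andbT; apply: lp_coord => //.
by rewrite /lp_sum psum_leE// -(lp_normE (lp_valP x)) x0.
Qed.

HB.instance Definition _ := Lmodule_isNormed.Build R[i] lp_space lpD lpZ lp0.

Lemma lp_rnormE (x : lp_space) : rnorm x = lp_norm x.
Proof. by []. Qed.

Lemma lp_rnorm_le (x : lp_space) (e : R) : 0 <= e ->
  (rnorm x <= e) = (lp_sum x <= (e `^ p)%:E)%E.
Proof. by move=> e0; rewrite /lp_sum psum_leE// -lee_fin lp_rnormE (lp_normE (lp_valP x)). Qed.

Let lp_complete (F : set_system lp_space) :
  ProperFilter F -> cauchy F -> cvg F.
Proof.
apply: (@sequence_space_complete _ _ lp_val
          (fun s e => (lp_sum s <= (e `^ p)%:E)%E)).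
- by move=> u v e e0; rewrite lp_rnorm_le.
- move=> u v n; apply: (@lp_coord (u - v)) (rnorm_ge0 _) _.
  by rewrite -lp_rnorm_le ?rnorm_ge0.
- move=> {}F y s e FF e0 yF sF; apply: psum_limit => // [n|A d d0].
    exact: rnorm_ge0.
  have AF : \forall v \near F, forall n, n \in A -> rnorm (lp_val v n - y n) < d.
    elim: A => [|a A IH]; first by apply: nearW => v n.
    apply: filterS2 (yF a d d0) IH => v va vA n.
    by rewrite inE => /predU1P[->//|/vA].
  have [v [vA vs]] := filter_ex (filterI AF sF).
  exists (fun n => rnorm (lp_val v n - s n)); split => //.
    by move=> n; exact: rnorm_ge0.
  move=> n nA; rewrite -(subrK (lp_val v n) (y n)) -addrA.
  by apply: le_trans (rnormD _ _) _; rewrite lerD2r rnormB ltW// vA.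
- move=> y /(_ 1 ltr01)[u yu].
  have yup : (fun n => y n - lp_val u n) \in lp_pred p1.
    by apply/lp_predP; apply: le_lt_trans yu _; rewrite ltry.
  exists (LpSeq yup + u); apply/funext => n /=.
  by rewrite -[LHS]/(y n - lp_val u n + lp_val u n) subrK.
Qed.

HB.instance Definition _ := Uniform_isComplete.Build lp_space lp_complete.

End LpSpace.

HB.lock Definition c0_norm (R : realType) (x : int -> R[i]) : R :=
  sup [set rnorm (x n) | n in [set: int]].

Section C0Space.
Variable R : realType.

Definition c0_pred : {pred int -> R[i]} := fun x =>
  `[< ((x k%:Z : R[i]^o) @[k --> \oo] --> (0 : R[i]^o)) /\
      ((x (- k%:Z) : R[i]^o) @[k --> \oo] --> (0 : R[i]^o)) >].

Record c0_space := C0Seq {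
  c0_val :> int -> R[i];
  _ : c0_val \in c0_pred
}.

HB.instance Definition _ := [isSub for c0_val].
HB.instance Definition _ := [Choice of c0_space by <:].

Lemma c0_predP x : reflect
  (forall e : R, 0 < e -> exists K : nat,
     forall n : int, (K <= `|n|)%N -> rnorm (x n) < e) (x \in c0_pred).
Proof.
apply: (iffP (asboolP _)) => [[xp xm] e e0|xe].
- have ec0 : 0 < e%:C :> R[i] by rewrite ltcR.
  move/cvgrPdist_lt : xp => /(_ _ ec0)[K1 _ K1P].
  move/cvgrPdist_lt : xm => /(_ _ ec0)[K2 _ K2P].
  exists (maxn K1 K2) => n; rewrite geq_max => /andP[n1 n2].
  rewrite -ltcR rnormE -normrN -sub0r.
  case: (intP n) n1 n2 => [|m|m] n1 n2; first exact: (K1P 0%N).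
    exact: (K1P m.+1).
  exact: (K2P m.+1).
- have H (s : nat -> int) : (forall k, `|s k|%N = k) ->
    (x (s k) : R[i]^o) @[k --> \oo] --> (0 : R[i]^o).
    move=> sE; apply/cvgrPdist_lt => e e0.
    have eE : e = (complex.Re e)%:C by rewrite RRe_real// gtr0_real.
    move: e0; rewrite eE ltcR => e0; have [K KP] := xe _ e0.
    exists K => // k /= Kk; rewrite sub0r normrN -rnormE ltcR KP//.
    by rewrite sE.
  by split; apply: H => k; rewrite ?abszN.
Qed.

Lemma c0_bounded (x : int -> R[i]) : x \in c0_pred ->
  exists M : R, forall n, rnorm (x n) <= M.
Proof.
move=> /c0_predP/(_ 1 ltr01)[K KP].
exists (1 + \sum_(k < K) (rnorm (x k%:Z) + rnorm (x (- k%:Z)))) => n.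
have S0 (k : nat) : 0 <= rnorm (x k%:Z) + rnorm (x (- k%:Z)).
  by rewrite addr_ge0 ?rnorm_ge0.
have [Kn|nK] := leqP K `|n|%N.
  by apply: le_trans (ltW (KP n Kn)) _; rewrite lerDl sumr_ge0.
rewrite (bigD1 (Ordinal nK))//= addrCA -[leLHS]addr0 lerD//.
  have [->|->] : n = `|n|%N%:Z \/ n = - (`|n|%N%:Z).
    by case: (intP n) => [|m|m]; [left|left|right].
  - by rewrite absz_nat lerDl rnorm_ge0.
  - by rewrite abszN absz_nat lerDr rnorm_ge0.
by rewrite addr_ge0// sumr_ge0.
Qed.

Lemma c0_submod_closed : submod_closed c0_pred.
Proof.
split.
  apply/c0_predP => e e0; exists 0%N => n _.
  by rewrite -[X in rnorm X]/(0 : R[i]) rnorm0.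
move=> a x y /c0_predP xP /c0_predP yP; apply/c0_predP => e e0.
have a0 : 0 < rnorm a + 1 by rewrite ltr_wpDl ?rnorm_ge0.
have e2 : 0 < e / 2 by rewrite divr_gt0.
have [K1 K1P] := xP _ (divr_gt0 e2 a0); have [K2 K2P] := yP _ e2.
exists (maxn K1 K2) => n; rewrite geq_max => /andP[/K1P xn /K2P yn].
rewrite -[X in rnorm X]/(a * x n + y n) [e]splitr.
apply: le_lt_trans (rnormD _ _) _; apply: ler_ltD => //.
rewrite rnormM; apply: le_trans (_ : (rnorm a + 1) * rnorm (x n) <= _).
  by rewrite ler_wpM2r ?rnorm_ge0// lerDl.
by rewrite mulrC -ler_pdivlMr// ltW.
Qed.

HB.instance Definition _ :=
  GRing.isSubmodClosed.Build _ _ c0_pred c0_submod_closed.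
HB.instance Definition _ := [SubChoice_isSubLmodule of c0_space by <:].

Lemma c0_valP (x : c0_space) : c0_val x \in c0_pred.
Proof. by case: x. Qed.

Lemma c0_norm_ge (x : int -> R[i]) n : x \in c0_pred -> rnorm (x n) <= c0_norm x.
Proof.
move=> xc; rewrite c0_norm.unlock; apply: ub_le_sup; last by exists n.
by have [M xM] := c0_bounded xc; exists M => _ [m _ <-].
Qed.

Lemma c0_norm_leP (x : int -> R[i]) (e : R) : x \in c0_pred ->
  c0_norm x <= e <-> forall n, rnorm (x n) <= e.
Proof.
move=> xc; split=> [xe n|xe]; first exact: le_trans (c0_norm_ge n xc) xe.
rewrite c0_norm.unlock; apply: ge_sup; first by exists (rnorm (x 0)), 0.
by move=> _ [n _ <-].
Qed.

Let c0D (x y : c0_space) :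
  (c0_norm (x + y)%R)%:C <= (c0_norm x)%:C + (c0_norm y)%:C :> R[i].
Proof.
have h : c0_norm (x + y)%R <= c0_norm x + c0_norm y.
  apply/c0_norm_leP => [|n]; first exact: c0_valP.
  apply: le_trans (rnormD (c0_val x n) (c0_val y n)) _.
  by apply: lerD; apply: c0_norm_ge; exact: c0_valP.
by move: h; rewrite -lecR => h; apply: le_trans h _; rewrite rmorphD.
Qed.

Let c0Z_le (a : R[i]) (x : c0_space) :
  c0_norm (a *: x)%R <= rnorm a * c0_norm x.
Proof.
apply/c0_norm_leP => [|n]; first exact: c0_valP.
rewrite -[X in rnorm X]/(a * c0_val x n) rnormM ler_wpM2l ?rnorm_ge0//.
exact: c0_norm_ge (c0_valP x).
Qed.

Let c0Z (a : R[i]) (x : c0_space) :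
  (c0_norm (a *: x)%R)%:C = `|a| * (c0_norm x)%:C :> R[i].
Proof.
have -> : c0_norm (a *: x)%R = rnorm a * c0_norm x.
  apply/eqP; rewrite eq_le c0Z_le/=.
  have [->|a0] := eqVneq a 0.
    rewrite rnorm0 mul0r.
    exact: le_trans (rnorm_ge0 _) (c0_norm_ge 0 (c0_valP (0 *: x))).
  have ra : 0 < rnorm a.
    rewrite lt_neqAle rnorm_ge0 andbT eq_sym.
    by apply: contra_neq a0 => /rnorm_eq0.
  rewrite mulrC -ler_pdivlMr//; apply/c0_norm_leP => [|n]; first exact: c0_valP.
  rewrite ler_pdivlMr// mulrC -rnormM.
  exact: c0_norm_ge (c0_valP (a *: x)).
by rewrite rmorphM/= rnormE.
Qed.

Let c00 (x : c0_space) : (c0_norm x)%:C = 0 :> R[i] -> x = 0.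
Proof.
move=> /complexI x0; apply: val_inj; apply/funext => n /=; apply: rnorm_eq0.
apply/eqP; rewrite eq_le rnorm_ge0 andbT -x0.
exact: c0_norm_ge (c0_valP x).
Qed.

HB.instance Definition _ := Lmodule_isNormed.Build R[i] c0_space c0D c0Z c00.

Lemma c0_rnormE (x : c0_space) : rnorm x = c0_norm x.
Proof. by []. Qed.

Let c0_complete (F : set_system c0_space) :
  ProperFilter F -> cauchy F -> cvg F.
Proof.
apply: (@sequence_space_complete _ _ c0_val
          (fun s e => forall n, rnorm (s n) <= e)).
- move=> u v e e0; rewrite c0_rnormE; split=> [h n|h].
    by apply: le_trans h; exact: c0_norm_ge (c0_valP (u - v)).
  by apply/c0_norm_leP => //; exact: c0_valP.
- by move=> u v n; rewrite c0_rnormE; exact: c0_norm_ge (c0_valP (u - v)).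
- move=> {}F y s e FF e0 yF sF n; apply/ler_addgt0Pr => d d0.
  have [v [vy vs]] := filter_ex (filterI (yF n d d0) sF).
  rewrite -(subrK (c0_val v n) (y n)) -addrA [leRHS]addrC.
  by apply: le_trans (rnormD _ _) _; rewrite lerD// rnormB ltW.
- move=> y yu.
  suff yc : y \in c0_pred by exists (C0Seq yc).
  apply/c0_predP => e e0; have e2 : 0 < e / 2 by rewrite divr_gt0.
  have [u uy] := yu _ e2; have /c0_predP/(_ _ e2)[K KP] := c0_valP u.
  exists K => n /KP un; rewrite -(subrK (c0_val u n) (y n)) [e]splitr.
  by apply: le_lt_trans (rnormD _ _) _; exact: ler_ltD.
Qed.

HB.instance Definition _ := Uniform_isComplete.Build c0_space c0_complete.

End C0Space.

Definition shift_seq (R : realType) (w : int -> R) (x : int -> R[i]) :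
  int -> R[i] := fun n => (w (n + 1))%:C * x (n + 1).

Section LpShift.
Variables (R : realType) (p : R) (p1 : 1 <= p) (w : int -> R).
Hypotheses (w_gt0 : forall n, 0 < w n) (w_ub : has_ubound (range w)).

Lemma lp_sum_translate (x : int -> R[i]) :
  lp_sum p (fun n => x (n + 1)) = lp_sum p x.
Proof.
rewrite /lp_sum /psum [RHS](reindex_esum setT _ (fun n : int => n + 1))//.
split=> // [m n _ _|n _]; first exact: addIr.
by exists (n - 1) => //; rewrite subrK.
Qed.

Lemma lp_sum_shift (M : R) (x : int -> R[i]) : (forall n, w n <= M) ->
  (lp_sum p (shift_seq w x) <= (M `^ p)%:E * lp_sum p x)%E.
Proof.
move=> wM; have M0 : 0 <= M by apply: le_trans (ltW (w_gt0 0)) (wM 0).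
rewrite -(lp_sum_translate x) /lp_sum -psumZ//; last first.
  by move=> n; exact: rnorm_ge0.
apply: psum_le => // n; rewrite rnorm_ge0 /shift_seq rnormM rnorm_real.
by rewrite ler_wpM2r ?rnorm_ge0// ger0_norm// ltW.
Qed.

Lemma lp_shift_subproof (x : lp_space p1) :
  shift_seq w (lp_val x) \in lp_pred p1.
Proof.
have [M wM] := w_ub; apply/lp_predP; apply: le_lt_trans (lp_sum_shift _ _) _.
  by move=> n; apply: wM; exists n.
by rewrite lte_mul_pinfty ?lee_fin ?powR_ge0 ?lp_valP.
Qed.

Definition lp_shift (x : lp_space p1) : lp_space p1 :=
  LpSeq (lp_shift_subproof x).

Lemma lp_shift_bounded (M : R) (x : lp_space p1) : (forall n, w n <= M) ->
  rnorm (lp_shift x) <= M * rnorm x.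
Proof.
move=> wM; have M0 : 0 <= M by apply: le_trans (ltW (w_gt0 0)) (wM 0).
rewrite lp_rnorm_le ?mulr_ge0 ?rnorm_ge0//.
apply: le_trans (lp_sum_shift _ wM) _.
by rewrite powRM ?rnorm_ge0// EFinM lee_wpmul2l ?lee_fin ?powR_ge0// -lp_rnorm_le
  ?rnorm_ge0.
Qed.

Let lp_shift_linear : linear lp_shift.
Proof.
move=> a x y; apply: val_inj; apply/funext => n /=.
rewrite /shift_seq -[X in _ * X = _]/(a * lp_val x (n + 1) + lp_val y (n + 1)).
by rewrite mulrDr mulrCA.
Qed.

HB.instance Definition _ :=
  GRing.isLinear.Build R[i] (lp_space p1) (lp_space p1) _ lp_shift
    lp_shift_linear.

End LpShift.

Section C0Shift.
Variables (R : realType) (w : int -> R).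
Hypotheses (w_gt0 : forall n, 0 < w n) (w_ub : has_ubound (range w)).

Lemma c0_shift_subproof (x : c0_space R) :
  shift_seq w (c0_val x) \in @c0_pred R.
Proof.
have [M wM] := w_ub; have {}wM n : w n <= M by apply: wM; exists n.
have M0 : 0 < M by apply: lt_le_trans (w_gt0 0) (wM 0).
apply/c0_predP => e e0; have /c0_predP/(_ _ (divr_gt0 e0 M0))[K KP] := c0_valP x.
exists K.+1 => n Kn.
have /KP : (K <= `|(n + 1)%R|)%N.
  by case: (intP n) Kn => [|m|m]; lia.
rewrite ltr_pdivlMr// mulrC => h; apply: le_lt_trans h.
by rewrite /shift_seq rnormM rnorm_real ler_wpM2r ?rnorm_ge0// gtr0_norm.
Qed.

Definition c0_shift (x : c0_space R) : c0_space R :=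
  C0Seq (c0_shift_subproof x).

Lemma c0_shift_bounded (M : R) (x : c0_space R) : (forall n, w n <= M) ->
  rnorm (c0_shift x) <= M * rnorm x.
Proof.
move=> wM; rewrite !c0_rnormE; apply/c0_norm_leP => [|n]; first exact: c0_valP.
rewrite -[X in rnorm X]/(shift_seq w (c0_val x) n) /shift_seq rnormM rnorm_real.
rewrite gtr0_norm// ler_pM ?rnorm_ge0 ?(ltW (w_gt0 _))//.
exact: c0_norm_ge (c0_valP x).
Qed.

Let c0_shift_linear : linear c0_shift.
Proof.
move=> a x y; apply: val_inj; apply/funext => n /=.
rewrite /shift_seq -[X in _ * X = _]/(a * c0_val x (n + 1) + c0_val y (n + 1)).
by rewrite mulrDr mulrCA.
Qed.

HB.instance Definition _ :=
  GRing.isLinear.Build R[i] (c0_space R) (c0_space R) _ c0_shift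
    c0_shift_linear.

End C0Shift.

Section StructuralStability.
Variables (R : realType) (X : completeNormedModType R[i]).
Local Open Scope ereal_scope.

Definition sup_norm (f : X -> X) : \bar R :=
  ereal_sup [set (rnorm (f x))%:E | x in [set: X]].

(* the best Lipschitz constant, +oo if there is none *)
Definition lip_const (f : X -> X) : \bar R :=
  ereal_inf [set L%:E | L in [set L : R | (0 <= L)%R /\ (L%:C)%C.-lipschitz f]].

Definition homeomorphism (f : X -> X) : Prop :=
  continuous f /\ exists g : X -> X, [/\ cancel f g, cancel g f & continuous g].

Definition strongly_structurally_stable (T : {linear X -> X}) : Prop :=
  forall e : R, (0 < e)%R -> exists2 d : R, (0 < d)%R &
  forall alpha : X -> X, lipschitz alpha ->
    sup_norm alpha <= d%:E -> lip_const alpha <= d%:E ->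
  exists phi : X -> X,
    [/\ sup_norm phi <= e%:E, homeomorphism (idfun \+ phi)%R &
        (T \o (idfun \+ phi) = (idfun \+ phi) \o (T \+ alpha))%R].

End StructuralStability.

(* The geometric-type means (w_k w_{k+1} ... w_{k+n})^{1/n} and
   (w_k w_{k-1} ... w_{k-n})^{1/n}: n+1 factors, exponent 1/n. *)
Section Conditions.
Variables (R : realType) (w : int -> R).

Definition fwd_mean (n : nat) (k : int) : R :=
  (\prod_(0 <= j < n.+1) w (k + j%:Z)) `^ n%:R^-1.

Definition bwd_mean (n : nat) (k : int) : R :=
  (\prod_(0 <= j < n.+1) w (k - j%:Z)) `^ n%:R^-1.

(* In the conditions below the convergence is part of the assertion. *)
Definition condition_A : Prop :=
  exists2 l : R,
    sup [set fwd_mean n k | k in [set: int]] @[n --> \oo] --> l & l < 1.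

Definition condition_B : Prop :=
  exists2 l : R,
    inf [set fwd_mean n k | k in [set: int]] @[n --> \oo] --> l & 1 < l.

Definition condition_C : Prop :=
  (exists2 l : R,
     sup [set bwd_mean n (- k) | k in [set k : int | 0 < k]] @[n --> \oo] --> l &
     l < 1) /\
  (exists2 l : R,
     inf [set fwd_mean n k | k in [set k : int | 0 < k]] @[n --> \oo] --> l &
     1 < l).

End Conditions.

(* Main.v *)
Require Import Defs.
From HB Require Import structures.
From mathcomp Require Import all_boot all_order all_algebra.
From mathcomp Require Import all_classical all_reals all_analysis.
From mathcomp Require Import ssrAC complex zify ring lra.

Set Implicit Arguments.
Unset Strict Implicit.
Unset Printing Implicit Defensive.

Import Order.TTheory GRing.Theory Num.Theory.
Import numFieldNormedType.Exports.

Local Open Scope classical_set_scope.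
Local Open Scope ring_scope.

(** Let [T] be the shift, and for a position [k] and a length [n] consider the
    product of the [n] consecutive weights that start at [k].

    Each of the three conditions is a geometric estimate for such products.  The
    supremum over [k] of the product of [n] factors is submultiplicative in [n],
    so Fekete's lemma makes the root means converge, and the limit is below [1]
    exactly when the products decay geometrically.  In all three cases there is
    a set [D] of positions (everything, nothing, or the negative half-line) such
    that the iterates of [T] decay on the coordinates of [D] and those of
    [T^-1] on the other coordinates ([dichotomy]).

    A dichotomy gives stability as follows.  With [P] and [Q] the coordinate
    projections onto [D] and its complement, the series
      L z = sum_(k >= 0) T^k (P z_(-k-1)) - sum_(k >= 0) T^(-k-1) (Q z_k)
    picks, linearly and continuously, the initial value of a bounded solution of
    [y_(n+1) = T y_n + z_n] for each bounded two-sided sequence [z]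
    ([green_operator]).  Let [S = T + alpha].  Then [phi x = - L (alpha (S^n x))_n]
    satisfies [T \o (I + phi) = (I + phi) \o S].  In the same way a fixed point
    [psi] of [psi y = L (alpha (T^n y + psi (T^n y)))_n] conjugates in the other
    direction.  Bounded solutions are not unique when [D] is the negative
    half-line, so uniqueness of the conjugacy is not available to show that
    [I + phi] and [I + psi] are inverse to each other; but both are obtained from
    the same selection [L].  One composition is the identity by substitution, and
    the deviation of the other from the identity is a fixed point of a
    contraction that fixes [0] ([green_strongly_structurally_stable]).

    Conversely, on the vectors supported at the moving position [q - i] at time
    [i], the shift acts as a scalar recurrence.  Perturb it by a constant [d]:
    this pseudo-orbit is an orbit of [T + alpha] as soon as [alpha] takes
    prescribed values of norm at most [d] at its points.  Adding a huge exact
    orbit to a finite segment makes the points as far from each other as wanted,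
    so that [alpha] can be a sum of very wide tents and has a small Lipschitz
    constant.  The conjugacy turns the pseudo-orbit into an orbit of [T] at
    distance at most [1], and the difference is a solution of
    [b_(i+1) = w_(q-i) b_i + d] bounded by [1] on the window
    ([window_solution]).  Where such a solution is nonnegative the products of
    weights contract, and where it is negative they expand; moreover it stays
    nonnegative once it is.  As the window grows, the position of the sign change
    goes to one of the two infinities along some windows or stays bounded, and
    these possibilities are the three conditions
    ([bounded_windows_dichotomy]). *)

(** * Root means of submultiplicative suprema *)

(** The bound by [(l + e) n + D] holds because one index [N] whose slope is close
    to the infimum controls all multiples of [N], and the remainder modulo [N]
    takes finitely many values. *)
Lemma fekete (R : realType) (a : nat -> R) (b : R) :
  (forall m n, a (m + n)%N <= a m + a n) -> (forall n, b * n%:R <= a n) ->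
  exists l : R, (forall n, l * n.+1%:R <= a n.+1) /\
    forall e, 0 < e -> exists D, forall n, a n <= (l + e) * n%:R + D.
Proof.
move=> asub ab; pose E := [set a n.+1 / n.+1%:R | n in [set: nat]].
have E0 : E !=set0 by exists (a 1%N / 1%:R), 0%N.
have Elb : has_lbound E.
  by exists b => _ [n _ <-]; rewrite ler_pdivlMr// ltr0n.
exists (inf E); split=> [n|e e0].
  by rewrite -ler_pdivlMr ?ltr0n//; apply: ge_inf => //; exists n.
have [_ [N _ <-] NE] := inf_adherent e0 (conj E0 Elb).
set x := a N.+1 / N.+1%:R in NE *.
pose D := \sum_(r < N.+1) `|a r - (inf E + e) * r%:R|; exists D => n.
rewrite {1 2}(divn_eq n N.+1); set r := (n %% N.+1)%N.
have rN : (r < N.+1)%N by rewrite ltn_mod.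
elim: (n %/ N.+1)%N => [|q IH].
  rewrite mul0n add0n -lerBlDl; apply: le_trans (ler_norm _) _.
  by rewrite /D (bigD1 (Ordinal rN))//= lerDl sumr_ge0.
rewrite mulSn -addnA; apply: le_trans (asub _ _) _.
rewrite natrD mulrDr -addrA lerD// -ler_pdivrMr ?ltr0n//.
exact: ltW.
Qed.

(** The three conditions are about products along the orbits of a map on a set of
    positions: the successor or the predecessor, on all positions or on a
    half-line that it preserves. *)
Section RootMeans.
Variables (R : realType) (K : Type) (A : set K) (s : K -> K) (u : K -> R).
Variables (m M : R).
Hypotheses (A0 : A !=set0) (As : forall k, A k -> A (s k)).
Hypotheses (m0 : 0 < m) (mu : forall k, m <= u k) (uM : forall k, u k <= M).

Definition orbit_prod (n : nat) (k : K) : R := \prod_(0 <= j < n) u (iter j s k).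

Definition geometric_decay (f : nat -> K -> R) : Prop :=
  exists C L : R, [/\ 0 < C, 0 < L, L < 1 & forall n k, A k -> f n k <= C * L ^+ n].

Let u0 k : 0 < u k. Proof. exact: lt_le_trans (mu k). Qed.

Lemma orbit_prod_gt0 n k : 0 < orbit_prod n k.
Proof. by rewrite prodr_gt0. Qed.

Let prod_gt0 n k : 0 < orbit_prod n k := orbit_prod_gt0 n k.

Let orbit_prod_ge n k : m ^+ n <= orbit_prod n k.
Proof.
rewrite -[n in m ^+ n]subn0 -prodr_const_nat; apply: ler_prod => j _.
by rewrite (ltW m0) mu.
Qed.

Let orbit_prod_le n k : orbit_prod n k <= M ^+ n.
Proof.
rewrite -[n in M ^+ n]subn0 -prodr_const_nat; apply: ler_prod => j _.
by rewrite (ltW (u0 _)) uM.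
Qed.

Let orbit_prodD n p k :
  orbit_prod (n + p) k = orbit_prod n k * orbit_prod p (iter n s k).
Proof.
rewrite /orbit_prod (big_cat_nat (n := n)) ?leq_addr//=; congr (_ * _).
rewrite -[X in \prod_(X <= _ < _) _]add0n big_addn addKn.
by apply: eq_bigr => j _; rewrite iterD.
Qed.

Let As_iter n k : A k -> A (iter n s k).
Proof. by move=> Ak; elim: n => //= n; exact: As. Qed.

Let S n := sup [set orbit_prod n k | k in A].

Let S_ge n k : A k -> orbit_prod n k <= S n.
Proof.
move=> Ak; apply: ub_le_sup; last by exists k.
by exists (M ^+ n) => _ [j _ <-].
Qed.

Let S_le n x : (forall k, A k -> orbit_prod n k <= x) -> S n <= x.
Proof.
move=> Ax; apply: ge_sup; last by move=> _ [k Ak <-]; exact: Ax.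
by have [k Ak] := A0; exists (orbit_prod n k), k.
Qed.

Let S_gt0 n : 0 < S n.
Proof. by have [k Ak] := A0; exact: lt_le_trans (S_ge n Ak). Qed.

Let S_submul n p : S (n + p) <= S n * S p.
Proof.
apply: S_le => k Ak; rewrite orbit_prodD ler_pM ?S_ge//; try exact: ltW.
exact: As_iter.
Qed.

(* At [n = 0] the exponent is [0] and both sides are [1]. *)
Let sup_mean n :
  sup [set orbit_prod n.+1 k `^ n%:R^-1 | k in A] = expR (ln (S n.+1) / n%:R).
Proof.
have -> : expR (ln (S n.+1) / n%:R) = S n.+1 `^ n%:R^-1.
  by rewrite /powR gt_eqF// mulrC.
have n0 : 0 <= n%:R^-1 :> R by rewrite invr_ge0 ler0n.
apply/eqP; rewrite eq_le; apply/andP; split.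
  apply: ge_sup => [|_ [k Ak <-]].
    by have [k Ak] := A0; exists (orbit_prod n.+1 k `^ n%:R^-1), k.
  by rewrite ge0_ler_powR ?S_ge// nnegrE ltW.
set X := sup _; have XP k : A k -> orbit_prod n.+1 k `^ n%:R^-1 <= X.
  move=> Ak; apply: ub_le_sup; last by exists k.
  exists (S n.+1 `^ n%:R^-1) => _ [j Aj <-].
  by rewrite ge0_ler_powR ?S_ge// nnegrE ltW.
have [k0 Ak0] := A0.
have X0 : 0 < X by apply: lt_le_trans (XP k0 Ak0); rewrite powR_gt0.
case: (posnP n) => [n_eq0|n_gt0].
  by move: (XP k0 Ak0); rewrite n_eq0 invr0 !powRr0.
have nN0 : n%:R != 0 :> R by rewrite pnatr_eq0 -lt0n.
have -> : X = (X `^ n%:R) `^ n%:R^-1 by rewrite -powRrM mulfV// powRr1// ltW.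
rewrite ge0_ler_powR ?nnegrE ?powR_ge0 ?(ltW (S_gt0 _))//.
apply: S_le => k Ak.
have -> : orbit_prod n.+1 k = (orbit_prod n.+1 k `^ n%:R^-1) `^ n%:R.
  by rewrite -powRrM mulVf// powRr1// ltW.
rewrite ge0_ler_powR ?nnegrE ?powR_ge0 ?(ltW X0) ?ler0n//.
exact: XP.
Qed.

(** The mean of [n.+1] factors has exponent [1 / n] instead of [1 / n.+1]; this
    does not change the limit because the logarithm of the supremum grows at
    most linearly. The lower estimate of that logarithm makes the limit less
    than [1] as soon as a single supremum is. *)
Lemma sup_mean_cvg : exists l : R,
  (forall n, l * n.+1%:R <= ln (S n.+1)) /\
  sup [set orbit_prod n.+1 k `^ n%:R^-1 | k in A] @[n --> \oo] --> expR l.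
Proof.
have [||l [la lD]] := @fekete R (fun n => ln (S n)) (ln m).
- move=> n p; rewrite -lnM ?posrE// ler_ln ?posrE ?mulr_gt0//.
- move=> n; rewrite mulr_natr -lnXn// ler_ln ?posrE ?exprn_gt0//.
  by have [k Ak] := A0; exact: le_trans (orbit_prod_ge n k) (S_ge n Ak).
exists l; split=> //; under eq_fun do rewrite sup_mean.
apply: continuous_cvg; first exact: continuous_expR.
have nD (D e : R) : 0 < e -> \forall n \near \oo, `|D| / n%:R < e.
  move=> e0; near=> n.
  rewrite ltr_pdivrMr; last by rewrite ltr0n; near: n; exists 1%N.
  rewrite mulrC -ltr_pdivrMr//; near: n; exact: nbhs_infty_gtr.
apply/cvgrPdist_le => e e0; have e2 : 0 < e / 2 by rewrite divr_gt0.
have [D DP] := lD _ e2.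
near=> n; have n0 : 0 < n%:R :> R by rewrite ltr0n; near: n; exists 1%N.
have lo : l * n.+1%:R <= ln (S n.+1) by [].
have hi := DP n.+1.
have n1 : `|l| / n%:R < e by near: n; exact: nD.
have n2 : `|D + (l + e / 2)| / n%:R < e / 2 by near: n; exact: nD.
rewrite ltr_pdivrMr// in n1; rewrite ltr_pdivrMr// in n2.
rewrite distrC ler_norml lerBrDr lerBlDr ler_pdivlMr// ler_pdivrMr//.
have := ler_norm (- l); rewrite normrN => ln1; have := ler_norm (D + (l + e / 2)).
move: lo hi; rewrite -natr1 => lo hi Dn; apply/andP; split; lra.
Unshelve. all: by end_near.
Qed.

(** From right to left, geometric decay makes one of the suprema smaller than
    [1]; from left to right, the finitely many lengths that precede the
    asymptotic regime are absorbed by the constant. *)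
Lemma sup_mean_lt1 :
  (exists2 l : R,
     sup [set orbit_prod n.+1 k `^ n%:R^-1 | k in A] @[n --> \oo] --> l & l < 1)
  <-> geometric_decay orbit_prod.
Proof.
split=> [[l lS l1]|[C [L [C0 L0 L1 CL]]]]; last first.
  have [l [la lS]] := sup_mean_cvg; exists (expR l) => //; rewrite expR_lt1.
  have [N NP] : exists N, C * L ^+ N.+1 < 1.
    have /cvgrPdist_lt/(_ C^-1) : L ^+ n @[n --> \oo] --> 0.
      by apply: cvg_expr; rewrite ger0_norm// ltW.
    rewrite invr_gt0 => /(_ C0)[N _ NP]; exists N.
    have := NP N.+1 (leqnSn N); rewrite /= sub0r normrN ger0_norm ?exprn_ge0 ?(ltW L0)//.
    by rewrite mulrC -ltr_pdivlMr// mul1r.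
  have SN : S N.+1 < 1 by apply: le_lt_trans NP; apply: S_le => k; exact: CL.
  have := le_lt_trans (la N) (_ : ln (S N.+1) < 0).
  by rewrite ln_lt0 ?S_gt0 ?SN// pmulr_llt0 ?ltr0n// => /(_ isT).
pose L := (l + 1) / 2.
have lL : l < L by rewrite /L ltr_pdivlMr// mulr_natr mulr2n; lra.
have L1 : L < 1 by rewrite /L ltr_pdivrMr//; lra.
move/cvgrPdist_lt : lS => /(_ (L - l)); rewrite subr_gt0 => /(_ lL)[N _ NP].
have SL n : (N <= n)%N -> expR (ln (S n.+1) / n%:R) < L.
  move=> /NP/=; rewrite sup_mean distrC => /(le_lt_trans (ler_norm _)).
  by rewrite ltrD2r.
have L0 : 0 < L by exact: lt_trans (expR_gt0 _) (SL N (leqnn N)).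
have M0 : 0 < M by have [k _] := A0; exact: lt_le_trans (u0 k) (uM k).
have SLn n : (N < n)%N -> S n.+1 <= L^-1 * L ^+ n.+1.
  move=> Nn; rewrite exprS mulKf ?gt_eqF//.
  have n0 : 0 < n%:R :> R by rewrite ltr0n (leq_ltn_trans _ Nn).
  rewrite -ler_ln ?posrE ?exprn_gt0// lnXn// -mulr_natr -ler_pdivrMr//.
  by rewrite -ler_expR lnK ?posrE//; exact: ltW (SL n (ltnW Nn)).
pose C := L^-1 + \sum_(n < N.+2) S n / L ^+ n.
have C0 : 0 < C.
  by rewrite ltr_pwDl ?invr_gt0// sumr_ge0// => n _; rewrite ltW// divr_gt0 ?exprn_gt0.
exists C, L; split=> // n k Ak; apply: le_trans (S_ge n Ak) _.
have [nN|nN] := ltnP n N.+2.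
  rewrite -ler_pdivrMr ?exprn_gt0// /C (bigD1 (Ordinal nN))//= addrCA lerDl.
  rewrite addr_ge0 ?invr_ge0 ?(ltW L0)// sumr_ge0// => i _.
  by rewrite ltW// divr_gt0 ?exprn_gt0.
case: n nN => // n nN; apply: le_trans (SLn n nN) _.
rewrite ler_wpM2r ?exprn_ge0 ?(ltW L0)// /C lerDl sumr_ge0// => i _.
by rewrite ltW// divr_gt0 ?exprn_gt0.
Qed.

End RootMeans.

Lemma orbit_prodV (R : realType) (K : Type) (s : K -> K) (u : K -> R) n k :
  orbit_prod s (fun k => (u k)^-1) n k = (orbit_prod s u n k)^-1.
Proof. by rewrite /orbit_prod prodfV. Qed.

(** Inverting the weights exchanges infima and suprema; the limit of the suprema
    is the exponential of a real number, hence nonzero, so that inversion is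
    continuous there. *)
Lemma inf_mean_gt1 (R : realType) (K : Type) (A : set K) (s : K -> K)
    (u : K -> R) (m M : R) : A !=set0 -> (forall k, A k -> A (s k)) ->
  0 < m -> (forall k, m <= u k) -> (forall k, u k <= M) ->
  (exists2 l : R,
     inf [set orbit_prod s u n.+1 k `^ n%:R^-1 | k in A] @[n --> \oo] --> l &
     1 < l)
  <-> geometric_decay A (fun n k => (orbit_prod s u n k)^-1).
Proof.
move=> A0 As m0 mu uM; pose v k := (u k)^-1.
have [k0 Ak0] := A0.
have u0 k : 0 < u k := lt_le_trans m0 (mu k).
have M0 : 0 < M := lt_le_trans (u0 k0) (uM k0).
have v0 : 0 < M^-1 by rewrite invr_gt0.
have vM k : M^-1 <= v k by rewrite lef_pV2 ?posrE// ?u0.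
have vm k : v k <= m^-1 by rewrite lef_pV2 ?posrE// ?u0.
have -> : (fun n k => (orbit_prod s u n k)^-1) = orbit_prod s v.
  by apply/funext => n; apply/funext => k; rewrite orbit_prodV.
have [l [_ lS]] := sup_mean_cvg A0 As v0 vM vm.
have vE n k : (orbit_prod s v n.+1 k) `^ n%:R^-1 =
    (orbit_prod s u n.+1 k `^ n%:R^-1)^-1.
  rewrite orbit_prodV -powR_inv1 ?ltW ?(orbit_prod_gt0 _ m0)//.
  by rewrite -powRrM mulrC powRrM powR_inv1// powR_ge0.
have inf_supV n : inf [set orbit_prod s u n.+1 k `^ n%:R^-1 | k in A] =
    (sup [set orbit_prod s v n.+1 k `^ n%:R^-1 | k in A])^-1.
  have p0 k : 0 < orbit_prod s u n.+1 k `^ n%:R^-1.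
    by rewrite powR_gt0// (orbit_prod_gt0 _ m0).
  set I := inf _; set Y := sup _.
  have IP k : A k -> I <= orbit_prod s u n.+1 k `^ n%:R^-1.
    move=> Ak; apply: ge_inf; last by exists k.
    by exists 0 => _ [j _ <-]; rewrite ltW.
  have I0 : 0 < I.
    apply: lt_le_trans (_ : (m ^+ n.+1) `^ n%:R^-1 <= _).
      by rewrite powR_gt0// exprn_gt0.
    apply: lb_le_inf => [|_ [k Ak <-]].
      by exists (orbit_prod s u n.+1 k0 `^ n%:R^-1), k0.
    rewrite ge0_ler_powR ?nnegrE ?invr_ge0 ?ler0n ?exprn_ge0 ?(ltW m0)//.
      by rewrite (ltW (orbit_prod_gt0 _ m0 _ _ _)).
    rewrite -[X in m ^+ X]subn0 -prodr_const_nat; apply: ler_prod => j _.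
    by rewrite (ltW m0) mu.
  have YI : Y <= I^-1.
    apply: ge_sup => [|_ [k Ak <-]].
      by exists (orbit_prod s v n.+1 k0 `^ n%:R^-1), k0.
    by rewrite vE lef_pV2 ?posrE// IP.
  have YP k : A k -> orbit_prod s v n.+1 k `^ n%:R^-1 <= Y.
    move=> Ak; apply: ub_le_sup; last by exists k.
    exists I^-1 => _ [j Aj <-].
    by rewrite vE lef_pV2 ?posrE// IP.
  have Y0 : 0 < Y.
    by apply: lt_le_trans (YP k0 Ak0); rewrite vE invr_gt0.
  apply/eqP; rewrite eq_le; apply/andP; split.
    by rewrite -[leLHS]invrK lef_pV2 ?posrE ?invr_gt0.
  apply: lb_le_inf => [|_ [k Ak <-]].
    by exists (orbit_prod s u n.+1 k0 `^ n%:R^-1), k0.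
  by rewrite -[leRHS]invrK lef_pV2 ?posrE ?invr_gt0// -vE YP.
rewrite (funext inf_supV).
have lV : (sup [set orbit_prod s v n.+1 k `^ n%:R^-1 | k in A])^-1 @[n --> \oo]
    --> (expR l)^-1 by apply: cvgV => //; rewrite gt_eqF ?expR_gt0.
rewrite -(sup_mean_lt1 A0 As v0 vM vm); split=> -[x xS x1].
  exists (expR l) => //; move: x1.
  rewrite -(cvg_unique (@norm_hausdorff _ R^o) lV xS).
  by rewrite invf_gt1// expR_gt0.
exists (expR l)^-1 => //; move: x1.
rewrite -(cvg_unique (@norm_hausdorff _ R^o) lS xS).
by rewrite invf_gt1// expR_gt0.
Qed.

(** * Products of consecutive weights *)

Definition wprod (R : realType) (w : int -> R) (k : int) (n : nat) : R :=
  \prod_(0 <= j < n) w (k + j%:Z).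

Section WeightProductAlgebra.
Variables (R : realType) (w : int -> R).
Implicit Types (k : int) (n : nat).

Lemma wprodD k n p : wprod w k (n + p) = wprod w k n * wprod w (k + n%:Z) p.
Proof.
rewrite /wprod (big_cat_nat (n := n)) ?leq_addr//=; congr (_ * _).
rewrite -[X in \prod_(X <= _ < _) _]add0n big_addn addKn.
by apply: eq_bigr => j _; congr w; lia.
Qed.

Lemma wprodSr k n : wprod w k n.+1 = wprod w k n * w (k + n%:Z).
Proof. by rewrite /wprod big_nat_recr. Qed.

Lemma wprodS k n : wprod w k n.+1 = w k * wprod w (k + 1) n.
Proof.
by rewrite -add1n wprodD; congr (_ * _); rewrite /wprod big_nat1 addr0.
Qed.

Lemma wprodV k n : wprod (fun j => (w j)^-1) k n = (wprod w k n)^-1.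
Proof. by rewrite /wprod prodfV. Qed.

End WeightProductAlgebra.

Section WeightProducts.
Variables (R : realType) (w : int -> R) (m M : R).
Hypotheses (m0 : 0 < m) (mw : forall k, m <= w k) (wM : forall k, w k <= M).
Implicit Types (k : int) (n : nat).

Lemma wprod_gt0 k n : 0 < wprod w k n.
Proof. by rewrite prodr_gt0// => j _; exact: lt_le_trans (mw _). Qed.

Let iter_succ j k : iter j (fun k : int => k + 1) k = k + j%:Z.
Proof. by elim: j => [|j IH] /=; rewrite ?IH; lia. Qed.

Let iter_pred j k : iter j (fun k : int => k - 1) k = k - j%:Z.
Proof. by elim: j => [|j IH] /=; rewrite ?IH; lia. Qed.

Let orbit_prod_succ n k : orbit_prod (fun k : int => k + 1) w n k = wprod w k n.
Proof. by apply: eq_bigr => j _; rewrite iter_succ. Qed.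

Let orbit_prod_pred n k :
  orbit_prod (fun k : int => k - 1) w n k = wprod w (k - n%:Z + 1) n.
Proof.
rewrite /orbit_prod big_nat_rev; apply: eq_big_nat => j /andP[_ jn].
by rewrite iter_pred; congr w; lia.
Qed.

(** The [n]-th iterate of the shift carries the coordinate [k + n] to the position
    [k] and multiplies it by the product of the weights at [k + 1, ..., k + n].
    So [D] is a set of coordinates on which the iterates of the shift decay
    geometrically, and on the complement of [D] those of its inverse do. *)
Definition dichotomy (D : pred int) : Prop :=
  exists C L : R, [/\ 0 < C, 0 < L, L < 1,
    forall k n, D (k + n%:Z) -> wprod w (k + 1) n <= C * L ^+ n &
    forall k n, ~~ D k -> (wprod w (k + 1) n)^-1 <= C * L ^+ n].

Let eq_limit_ex (f g : nat -> R) (Q : R -> Prop) : f =1 g ->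
  (exists2 l : R, f n @[n --> \oo] --> l & Q l) <->
  (exists2 l : R, g n @[n --> \oo] --> l & Q l).
Proof. by move=> /funext->. Qed.

Lemma condition_AE : condition_A w <-> dichotomy predT.
Proof.
rewrite /condition_A.
have H := @sup_mean_lt1 R int setT (fun k => k + 1) w m M _ _ m0 mw wM.
have {H} [|//|H1 H2] := H; first by exists 0.
have E n : sup [set fwd_mean w n k | k in [set: int]] =
    sup [set orbit_prod (fun k : int => k + 1) w n.+1 k `^ n%:R^-1
                  | k in [set: int]].
  congr (sup _); apply: eq_imagel => k _.
  by rewrite orbit_prod_succ.
apply: iff_trans (eq_limit_ex _ E) _; split=> [/H1|]; last first.
  move=> [C [L [C0 L0 L1 CL _]]]; apply: H2; exists C, L; split=> // n k _.
  by rewrite orbit_prod_succ -(subrK 1 k) CL.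
move=> [C [L [C0 L0 L1 CL]]]; exists C, L; split=> // k n _.
by rewrite -orbit_prod_succ CL.
Qed.

Lemma condition_BE : condition_B w <-> dichotomy pred0.
Proof.
rewrite /condition_B.
have H := @inf_mean_gt1 R int setT (fun k => k + 1) w m M _ _ m0 mw wM.
have {H} [|//|H1 H2] := H; first by exists 0.
have E n : inf [set fwd_mean w n k | k in [set: int]] =
    inf [set orbit_prod (fun k : int => k + 1) w n.+1 k `^ n%:R^-1
                  | k in [set: int]].
  congr (inf _); apply: eq_imagel => k _.
  by rewrite orbit_prod_succ.
apply: iff_trans (eq_limit_ex _ E) _; split=> [/H1|]; last first.
  move=> [C [L [C0 L0 L1 _ CL]]]; apply: H2; exists C, L; split=> // n k _.
  by rewrite orbit_prod_succ -(subrK 1 k) CL.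
move=> [C [L [C0 L0 L1 CL]]]; exists C, L; split=> // k n _.
by rewrite -orbit_prod_succ CL.
Qed.

(** On the negative side the means run backwards from [-1], and an interval read
    backwards from its right end has the same product. *)
Lemma condition_CE : condition_C w <-> dichotomy (fun k => k < 0).
Proof.
rewrite /condition_C.
have H := @sup_mean_lt1 R int [set k | k < 0] (fun k => k - 1) w m M _ _ m0 mw wM.
have {H} [||H1 H2] := H; first by exists (- 1).
  by move=> k /=; lia.
have H := @inf_mean_gt1 R int [set k | 0 < k] (fun k => k + 1) w m M _ _ m0 mw wM.
have {H} [||H3 H4] := H; first by exists 1.
  by move=> k /=; lia.
have E1 n : inf [set fwd_mean w n k | k in [set k : int | 0 < k]] =
    inf [set orbit_prod (fun k : int => k + 1) w n.+1 k `^ n%:R^-1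
                  | k in [set k | 0 < k]].
  congr (inf _); apply: eq_imagel => k _.
  by rewrite orbit_prod_succ.
have E2 n : sup [set bwd_mean w n (- k) | k in [set k : int | 0 < k]] =
    sup [set orbit_prod (fun k : int => k - 1) w n.+1 k `^ n%:R^-1
                  | k in [set k | k < 0]].
  congr (sup _); apply/seteqP; split => _ [k /= k0 <-].
    exists (- k); first by rewrite /=; lia.
    by congr (_ `^ _); apply: eq_bigr => j _; rewrite iter_pred.
  exists (- k); first by rewrite /=; lia.
  by congr (_ `^ _); apply: eq_bigr => j _; rewrite iter_pred opprK.
split=> [[/(eq_limit_ex _ E2)/H1 + /(eq_limit_ex _ E1)/H3]|]; last first.
  move=> [C [L [C0 L0 L1 CL1 CL2]]]; split.
    apply/(eq_limit_ex _ E2)/H2; exists C, L; split=> // n k /= k0.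
    by rewrite orbit_prod_pred CL1//; lia.
  apply/(eq_limit_ex _ E1)/H4; exists C, L; split=> // n k /= k0.
  by rewrite orbit_prod_succ -(subrK 1 k) CL2//; lia.
move=> [C [L [C0 L0 L1 CL]]] [C' [L' [C'0 L'0 L'1 CL']]].
have L2 : 0 < Num.max L L' by rewrite lt_max L0.
have C2 : 0 < Num.max C C' by rewrite lt_max C0.
exists (Num.max C C'), (Num.max L L'); split=> //.
- by rewrite gt_max L1.
- move=> k n k0; have := CL n (k + n%:Z) k0; rewrite orbit_prod_pred addrK.
  move=> /le_trans; apply; rewrite ler_pM ?exprn_ge0 ?(ltW L0) ?(ltW C0)//.
    by rewrite le_max lexx.
  by rewrite lerXn2r ?nnegrE ?(ltW L0) ?(ltW L2)// le_max lexx.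
- move=> k n k0; have := CL' n (k + 1); rewrite orbit_prod_succ /=.
  have k1 : 0 < k + 1 by clear -k0; lia.
  move=> /(_ k1)/le_trans; apply; rewrite ler_pM ?exprn_ge0 ?(ltW L'0) ?(ltW C'0)//.
    by rewrite le_max lexx orbT.
  by rewrite lerXn2r ?nnegrE ?(ltW L'0) ?(ltW L2)// le_max lexx orbT.
Qed.

End WeightProducts.

(** * Norm estimates in a complex Banach space *)

Lemma subrACA (V : zmodType) (a b c d : V) : (a - b) - (c - d) = (a - c) - (b - d).
Proof. by rewrite !opprB addrACA [RHS]addrACA [- b + _]addrC. Qed.

Section RealNormedAnalysis.
Variables (R : realType) (X : completeNormedModType R[i]).
Implicit Types (f g : X -> X) (x y : X) (e d r : R).

Lemma rnorm_triangle (y x z : X) : rnorm (x - z) <= rnorm (x - y) + rnorm (y - z).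
Proof. by rewrite -[x in leLHS](subrK y) -addrA rnormD. Qed.

Lemma complex_gt0E (e : R[i]) : 0 < e -> e = (complex.Re e)%:C%C.
Proof. by move=> e0; rewrite RRe_real// gtr0_real. Qed.

Lemma continuous_rnormP f : continuous f <->
  forall x e, 0 < e -> exists2 d, 0 < d &
    forall y, rnorm (x - y) < d -> rnorm (f x - f y) < e.
Proof.
split=> [fc x e e0|fc x].
  have /cvgrPdist_lt/(_ e%:C%C) := fc x.
  rewrite ltcR => /(_ e0) /nbhs_ballP[d /= d0]; rewrite -ball_normE => dP.
  exists (complex.Re d) => [|y yd]; first by rewrite -ltcR -complex_gt0E.
  by rewrite -ltcR rnormE; apply: dP; rewrite /= -rnormE (complex_gt0E d0) ltcR.
apply/cvgrPdist_lt => e e0.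
have [|d d0 dP] := fc x (complex.Re e); first by rewrite -ltcR -complex_gt0E.
apply/nbhs_ballP; exists d%:C%C; first by rewrite /= ltcR.
move=> y; rewrite -ball_normE/= -rnormE ltcR => /dP.
by rewrite -rnormE (complex_gt0E e0) ltcR.
Qed.

Lemma geometric_small (D q e : R) : 0 <= q -> q < 1 -> 0 < e ->
  exists n, D * q ^+ n <= e.
Proof.
move=> q0 q1 e0; have : D * q ^+ n @[n --> \oo] --> D * 0.
  by apply: cvgMr; apply: cvg_expr; rewrite ger0_norm.
rewrite mulr0 => /cvgrPdist_lt/(_ e e0)[N _ NP]; exists N.
have := NP N (leqnn N); rewrite /= sub0r normrN => /ltW.
exact/le_trans/ler_norm.
Qed.

Lemma rnorm_geometric_eq0 (q D : R) x : 0 <= q -> q < 1 ->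
  (forall n, rnorm x <= D * q ^+ n) -> x = 0.
Proof.
move=> q0 q1 xD; apply/rnorm_eq0/eqP; rewrite eq_le rnorm_ge0 andbT.
apply/ler_addgt0Pr => e e0; rewrite add0r.
by have [n] := geometric_small D q0 q1 e0; apply: le_trans.
Qed.

Lemma rnorm_sum n (F : nat -> X) :
  rnorm (\sum_(k < n) F k) <= \sum_(k < n) rnorm (F k).
Proof.
elim: n => [|n IH]; first by rewrite !big_ord0 rnorm0.
by rewrite !big_ord_recr/=; apply: le_trans (rnormD _ _) _; rewrite lerD2r.
Qed.

(** Completeness in the quantitative form used for Picard iteration and for
    series dominated by a geometric series. *)
Lemma geometric_cauchy_limit (u : nat -> X) (D q : R) : 0 <= q -> q < 1 ->
  (forall n, rnorm (u n.+1 - u n) <= D * q ^+ n) ->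
  exists l, forall n, rnorm (l - u n) <= D / (1 - q) * q ^+ n.
Proof.
move=> q0 q1 uD; have q1' : 0 < 1 - q by rewrite subr_gt0.
have D0 : 0 <= D by have := uD 0%N; rewrite expr0 mulr1; apply: le_trans; exact: rnorm_ge0.
have uk n k : rnorm (u (n + k)%N - u n) <= D / (1 - q) * q ^+ n.
  have : rnorm (u (n + k)%N - u n) <= D / (1 - q) * (q ^+ n - q ^+ (n + k)).
    elim: k => [|k IH]; first by rewrite addn0 !subrr rnorm0 mulr0.
    apply: le_trans (rnorm_triangle (u (n + k)%N) _ _) _; rewrite addnS.
    apply: le_trans (lerD (uD _) IH) _; rewrite exprS.
    suff -> : D * q ^+ (n + k) = D / (1 - q) * (q ^+ (n + k) * (1 - q)).
      by rewrite -mulrDr ler_wpM2l ?divr_ge0 ?(ltW q1')//; lra.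
    by field; rewrite gt_eqF.
  move=> /le_trans; apply; rewrite ler_wpM2l ?divr_ge0 ?(ltW q1')//.
  by rewrite gerBl exprn_ge0.
have uc : cauchy (u n @[n --> \oo]).
  apply/cauchyP => e e0; have e0' := e0; rewrite (complex_gt0E e0) ltcR in e0'.
  have e2 : 0 < complex.Re e / 2 by rewrite divr_gt0.
  have [N NP] := geometric_small (D / (1 - q)) q0 q1 e2.
  exists (u N); exists N => // n /= Nn.
  rewrite -ball_normE/= -rnormE (complex_gt0E e0) ltcR rnormB.
  have := le_trans (uk N (n - N)%N) NP; rewrite subnKC// => /le_lt_trans; apply.
  by rewrite ltr_pdivrMr// ltr_pMr// ltr1n.
have /cauchy_cvgP/cvg_ex[l ul] := uc; exists l => n; apply/ler_addgt0Pr => e e0.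
move/cvgrPdist_lt : ul => /(_ e%:C%C); rewrite ltcR => /(_ e0)[N _ NP].
apply: le_trans (rnorm_triangle (u (n + N)%N) _ _) _.
rewrite addrC; apply: lerD => //.
by apply: ltW; rewrite -ltcR rnormE; apply: NP; rewrite /= leq_addl.
Qed.

Lemma continuous_uniform_limit (F : nat -> X -> X) g :
  (forall n, continuous (F n)) ->
  (forall e, 0 < e -> exists n, forall x, rnorm (g x - F n x) <= e) ->
  continuous g.
Proof.
move=> Fc Fg; apply/continuous_rnormP => x e e0.
have e3 : 0 < e / 3 by rewrite divr_gt0.
have [n nP] := Fg _ e3; move/continuous_rnormP : (Fc n) => /(_ x _ e3)[d d0 dP].
exists d => // y /dP xy.
apply: le_lt_trans (rnorm_triangle (F n x) _ _) _.
have -> : e = e / 3 + (e / 3 + e / 3) by field.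
apply: ler_ltD => //; apply: le_lt_trans (rnorm_triangle (F n y) _ _) _.
by apply: ltr_leD => //; rewrite rnormB.
Qed.

(** Banach's fixed point theorem for the distance of uniform convergence, which is
    infinite in general: the start [f0] and its image must be at finite
    distance. *)
Lemma picard (Phi : (X -> X) -> X -> X) (f0 : X -> X) (D q : R) :
  0 <= q -> q < 1 -> continuous f0 ->
  (forall f, continuous f -> continuous (Phi f)) ->
  (forall f g r, (forall x, rnorm (f x - g x) <= r) ->
     forall x, rnorm (Phi f x - Phi g x) <= q * r) ->
  (forall x, rnorm (Phi f0 x - f0 x) <= D) ->
  exists f, continuous f /\ forall x, Phi f x = f x.
Proof.
move=> q0 q1 f0c Phic Phiq PhiD; pose F n := iter n Phi f0.
have FD n x : rnorm (F n.+1 x - F n x) <= D * q ^+ n.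
  elim: n x => [|n IH] x; first by rewrite expr0 mulr1; exact: PhiD.
  by rewrite exprS mulrCA; exact: (Phiq (F n.+1) (F n) _ IH).
have Fc n : continuous (F n) by elim: n => [|n]; [exact: f0c|exact: Phic].
have /choice[f fF] x := geometric_cauchy_limit q0 q1 (FD^~ x).
have unif e := @geometric_small (D / (1 - q)) q e q0 q1.
exists f; split.
  apply: (continuous_uniform_limit Fc) => e /unif[n nP]; exists n => x.
  exact: le_trans (fF x n) nP.
move=> x; apply/eqP; rewrite -subr_eq0; apply/eqP/rnorm_eq0/eqP.
rewrite eq_le rnorm_ge0 andbT; apply/ler_addgt0Pr => e e0; rewrite add0r.
have e2 : 0 < e / 2 by rewrite divr_gt0.
have [n nP] := unif _ e2.
apply: le_trans (rnorm_triangle (F n.+1 x) _ _) _.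
have D0 : 0 <= D by apply: le_trans (PhiD x); exact: rnorm_ge0.
rewrite [e]splitr; apply: lerD; last first.
  rewrite rnormB; apply: le_trans (fF x n.+1) _; apply: le_trans nP.
  rewrite exprS ler_wpM2l ?divr_ge0 ?subr_ge0 ?(ltW q1)//.
  by rewrite ler_piMl ?exprn_ge0// ltW.
apply: le_trans (_ : q * (e / 2) <= _); last by rewrite ler_piMl ?(ltW q1) ?(ltW e2).
by apply: (Phiq f (F n)) => z; apply: le_trans nP.
Qed.

End RealNormedAnalysis.

(** * The bounded solution of an inhomogeneous linear recurrence *)

Section GreenOperator.
Variables (R : realType) (X : completeNormedModType R[i]).
Implicit Types (x y : X) (z : int -> X) (e d r : R).

Definition bounded_by r z : Prop := forall n, rnorm (z n) <= r.

(** If [y_0 = L z] and [y_n] is [L] applied to the [n]-th translate of [z], the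
    fourth clause says [y_(n+1) = T y_n + z_n]. The last clause is continuity for
    coordinatewise convergence of bounded sequences, uniformly on bounded
    sets. *)
Definition green_operator (T : X -> X) (L : (int -> X) -> X) (K : R) : Prop :=
  [/\ 0 < K,
   forall r z, bounded_by r z -> rnorm (L z) <= K * r,
   forall r z z', bounded_by r z -> bounded_by r z' ->
     L (fun n => z n - z' n) = L z - L z',
   forall r z, bounded_by r z -> L (fun n => z (n + 1)) = T (L z) + z 0 &
   forall r e, 0 < e -> exists N : nat, exists2 d, 0 < d &
     forall z, bounded_by r z ->
       (forall n : int, (`|n| <= N)%N -> rnorm (z n) <= d) -> rnorm (L z) <= e].

(** Here [U k] is [T^k P] and [V k] is [T^(-k-1) Q] for some decomposition of the
    identity as [P + Q]. The recurrence holds because the two series telescope, up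
    to terms of order [q ^+ n] after [n] steps. *)
Lemma green_operator_exists (T : {linear X -> X}) (U V : nat -> {linear X -> X})
    (C q M : R) : 0 < C -> 0 <= q -> q < 1 -> 0 <= M ->
  (forall x, rnorm (T x) <= M * rnorm x) ->
  (forall k x, rnorm (U k x) <= C * q ^+ k * rnorm x) ->
  (forall k x, rnorm (V k x) <= C * q ^+ k * rnorm x) ->
  (forall k x, T (U k x) = U k.+1 x) -> (forall k x, T (V k.+1 x) = V k x) ->
  (forall x, U 0%N x + T (V 0%N x) = x) ->
  exists L K, green_operator T L K.
Proof.
move=> C0 q0 q1 M0 TM UC VC TU TV UV; have q1' : 0 < 1 - q by rewrite subr_gt0.
pose B := 2 * C / (1 - q).
have B0 : 0 < B by rewrite divr_gt0// mulr_gt0.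
pose term z k := U k (z (- k%:Z - 1)) - V k (z k%:Z).
pose p z n := \sum_(k < n) term z k.
have termP r z k : bounded_by r z -> rnorm (term z k) <= 2 * C * r * q ^+ k.
  move=> zr; apply: le_trans (rnormD _ _) _; rewrite rnormN.
  have Cr n : C * q ^+ k * rnorm (z n) <= C * q ^+ k * r.
    by rewrite ler_wpM2l// mulr_ge0 ?exprn_ge0 ?(ltW C0).
  have -> : 2 * C * r * q ^+ k = C * q ^+ k * r + C * q ^+ k * r by ring.
  by apply: lerD; apply: le_trans (Cr _).
(* Choosing the limit with the smallest bound of [z] makes the estimate valid for
   all bounds at once. *)
have ex_lim z : exists l, forall r, bounded_by r z ->
    forall n, rnorm (l - p z n) <= B * r * q ^+ n.
  have [[r0 zr0]|nz] := pselect (exists r, bounded_by r z); last first.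
    by exists 0 => r zr; case: nz; exists r.
  pose r1 := sup (range (fun n => rnorm (z n))).
  have zr1 : bounded_by r1 z.
    move=> n; apply: ub_le_sup; last by exists n.
    by exists r0 => _ [j _ <-].
  have pz n : rnorm (p z n.+1 - p z n) <= 2 * C * r1 * q ^+ n.
    by rewrite {1}/p big_ord_recr/= addrC addrK termP.
  have [l lP] := geometric_cauchy_limit q0 q1 pz; exists l => r zr n.
  apply: le_trans (lP n) _; rewrite ler_wpM2r ?exprn_ge0//.
  rewrite /B -!mulrA ler_pM2l// ler_pM2l// mulrC ler_pM2l ?invr_gt0//.
  by apply: ge_sup => [|_ [n0 _ <-]//]; exists (rnorm (z 0)), 0.
have [L LP] := choice ex_lim; exists L, B; split=> //.
- by move=> r z /LP/(_ 0%N); rewrite /p big_ord0 subr0 expr0 mulr1.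
- move=> r z z' zr z'r; have zz' : bounded_by (r + r) (fun n => z n - z' n).
    by move=> n; apply: le_trans (rnormD _ _) _; rewrite rnormN lerD.
  apply/eqP; rewrite -subr_eq0; apply/eqP.
  apply: (@rnorm_geometric_eq0 _ _ q (B * (r + r) + (B * r + B * r))) => // n.
  have pE : p (fun n => z n - z' n) n = p z n - p z' n.
    rewrite /p -sumrB; apply: eq_bigr => k _.
    by rewrite /term !linearB/= addrACA.
  have -> : L (fun n => z n - z' n) - (L z - L z') =
      (L (fun n => z n - z' n) - p (fun n => z n - z' n) n) -
      ((L z - p z n) - (L z' - p z' n)).
    by rewrite pE (subrACA (L z)) [- (_ - (_ - _))]opprB subrKA.
  apply: le_trans (rnormD _ _) _; rewrite rnormN 2!mulrDl.
  apply: lerD; first exact: LP zz' n.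
  by apply: le_trans (rnormD _ _) _; rewrite rnormN lerD// LP.
- move=> r z zr; have szr : bounded_by r (fun n => z (n + 1)) by move=> n; exact: zr.
  have pS n : p (fun n => z (n + 1)) n =
      T (p z n) + z 0 - (U n (z (- n%:Z)) + T (V n (z n%:Z))).
    elim: n => [|n IH]; first by rewrite /p !big_ord0 linear0 UV oppr0 add0r subrr.
    rewrite /p !big_ord_recr/= -/(p _ _) -/(p _ _) IH.
    rewrite (linearD T)/= /term (linearB T)/= TU TV.
    have -> : - n%:Z - 1 + 1 = - n%:Z by lia.
    have -> : n%:Z + 1 = n.+1%:Z by lia.
    have -> : - n.+1%:Z = - n%:Z - 1 by lia.
    rewrite !opprD !addrA [LHS](ACl (1*2*4*6*(3*5)))/= addNr addr0.
    by rewrite [RHS](ACl (1*4*3*6*(2*5)))/= subrr addr0.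
  apply/eqP; rewrite -subr_eq0; apply/eqP.
  apply: (@rnorm_geometric_eq0 _ _ q
    (B * r + (M * (B * r) + (C * r + M * (C * r))))) => // n.
  have -> : L (fun n => z (n + 1)) - (T (L z) + z 0) =
      (L (fun n => z (n + 1)) - p (fun n => z (n + 1)) n) -
      (T (L z - p z n) + (U n (z (- n%:Z)) + T (V n (z n%:Z)))).
    rewrite pS (linearB T)/= !opprD !opprK !addrA.
    rewrite [RHS](ACl (1*6*3*(2*7)*(4*8)*(5*9)))/=.
    by rewrite addNr !subrr !addr0.
  have Cr (W : nat -> {linear X -> X}) k :
      (forall k x, rnorm (W k x) <= C * q ^+ k * rnorm x) ->
      rnorm (W n (z k)) <= C * r * q ^+ n.
    move=> WC; apply: le_trans (WC _ _) _.
    by rewrite mulrAC ler_wpM2r ?exprn_ge0// ler_pM2l.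
  apply: le_trans (rnormD _ _) _; rewrite rnormN !mulrDl; apply: lerD; first exact: LP.
  apply: le_trans (rnormD _ _) _; apply: lerD.
    by apply: le_trans (TM _) _; rewrite -mulrA ler_wpM2l// LP.
  apply: le_trans (rnormD _ _) _; apply: lerD; first exact: Cr.
  by apply: le_trans (TM _) _; rewrite -mulrA ler_wpM2l// Cr.
- move=> r e e0; have e2 : 0 < e / 2 by rewrite divr_gt0.
  have [N NP] := geometric_small (B * r) q0 q1 e2.
  have N1 : 0 < 2 * C * N%:R + 1 by rewrite ltr_wpDl// mulr_ge0// mulr_ge0// ltW.
  exists N, (e / 2 / (2 * C * N%:R + 1)); first by rewrite divr_gt0.
  move=> z zr zd; rewrite -[L z](subrK (p z N)); apply: le_trans (rnormD _ _) _.
  rewrite [e]splitr; apply: lerD; first exact: le_trans (LP z r zr N) NP.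
  set d := _ / _ in zd; have d0 : 0 < d by rewrite divr_gt0.
  have zdk k : (k < N)%N -> rnorm (term z k) <= 2 * C * d.
    move=> kN; apply: le_trans (rnormD _ _) _; rewrite rnormN.
    have -> : 2 * C * d = C * d + C * d by ring.
    have Cd (n : int) : (`|n| <= N)%N -> C * q ^+ k * rnorm (z n) <= C * d.
      move=> nN; rewrite -mulrA ler_pM2l//; apply: le_trans (zd n nN).
      by rewrite ler_piMl ?rnorm_ge0// exprn_ile1// ltW.
    by apply: lerD; [apply: le_trans (UC _ _) _|apply: le_trans (VC _ _) _];
      apply: Cd; clear -kN; lia.
  apply: le_trans (rnorm_sum _ _) _.
  apply: le_trans (_ : \sum_(k < N) 2 * C * d <= _).
    by apply: ler_sum => k _; exact: zdk.
  rewrite sumr_const card_ord -[leLHS]mulr_natr.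
  have -> : 2 * C * d * N%:R = e / 2 * (2 * C * N%:R / (2 * C * N%:R + 1)).
    by rewrite /d; field; rewrite gt_eqF.
  by rewrite ler_piMr ?(ltW e2)// ler_pdivrMr// mul1r lerDl.
Qed.

End GreenOperator.

(** * Strong structural stability from a Green operator *)

Section Stability.
Variables (R : realType) (X : completeNormedModType R[i]).

Lemma sup_normP (f : X -> X) (e : R) :
  (sup_norm f <= e%:E)%E <-> forall x, rnorm (f x) <= e.
Proof.
split=> [fe x|fe].
  by rewrite -lee_fin; apply: le_trans fe; apply: ereal_sup_ubound; exists x.
by apply: ge_ereal_sup => _ [x _ <-]; rewrite lee_fin.
Qed.

Lemma lip_constP (f : X -> X) (L : R) : 0 <= L ->
  (lip_const f <= L%:E)%E <->
  forall x y, rnorm (f x - f y) <= L * rnorm (x - y).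
Proof.
move=> L0; split=> [fL x y|fL].
  apply/ler_addgt0Pr => e e0.
  have d0 : 0 < e / (rnorm (x - y) + 1) by rewrite divr_gt0// ltr_wpDl ?rnorm_ge0.
  have : (lip_const f < (L + e / (rnorm (x - y) + 1))%:E)%E.
    by apply: le_lt_trans fL _; rewrite lte_fin ltrDl.
  move=> /ereal_inf_lt[_ [K [K0 fK] <-]]; rewrite lte_fin => KL.
  have := fK (x, y) (conj I I); rewrite /= -!rnormE -rmorphM/= lecR => /le_trans; apply.
  apply: le_trans (ler_wpM2r (rnorm_ge0 _) (ltW KL)) _.
  rewrite mulrDl lerD2l mulrAC ler_pdivrMr ?ltr_wpDl ?rnorm_ge0//.
  by rewrite ler_pM2l// lerDl.
apply: ereal_inf_lbound; exists L => //; split=> // -[x y] _ /=.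
by rewrite -!rnormE -rmorphM/= lecR; exact: fL.
Qed.

Implicit Types (f g h S Si : X -> X) (x y : X) (n : int).

Lemma continuous_comp_fun f g : continuous f -> continuous g -> continuous (g \o f).
Proof. by move=> fc gc x; apply: continuous_comp; [exact: fc|exact: gc]. Qed.

Lemma continuous_add_fun f g : continuous f -> continuous g ->
  continuous (fun x => f x + g x).
Proof. by move=> fc gc x; apply: cvgD; [exact: fc|exact: gc]. Qed.

Lemma continuous_sub_fun f g : continuous f -> continuous g ->
  continuous (fun x => f x - g x).
Proof. by move=> fc gc x; apply: cvgB; [exact: fc|exact: gc]. Qed.

Lemma continuous_id_fun : continuous (fun x => x).
Proof. by move=> x; exact: cvg_id. Qed.

Lemma lipschitz_continuous_fun f (M : R) : 0 <= M ->
  (forall x y, rnorm (f x - f y) <= M * rnorm (x - y)) -> continuous f.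
Proof.
move=> M0 fM; apply/continuous_rnormP => x e e0.
have M1 : 0 < M + 1 by rewrite ltr_wpDl.
exists (e / (M + 1)) => [|y xy]; first by rewrite divr_gt0.
apply: le_lt_trans (fM x y) _; rewrite ltr_pdivlMr// in xy.
by apply: le_lt_trans xy; rewrite mulrC ler_wpM2l ?rnorm_ge0// lerDl.
Qed.

Definition two_sided_orbit S Si x n : X :=
  match n with Posz k => iter k S x | Negz k => iter k.+1 Si x end.

Lemma two_sided_orbit_shift S Si x n : cancel S Si ->
  two_sided_orbit S Si (S x) n = two_sided_orbit S Si x (n + 1).
Proof.
move=> SK; case: n => [k|[|k]].
- have -> : Posz k + 1 = Posz k.+1 by lia.
  by rewrite /two_sided_orbit iterSr.
- by have -> : Negz 0%N + 1 = Posz 0%N by []; rewrite /= SK.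
- have -> : Negz k.+1 + 1 = Negz k by rewrite !NegzE; lia.
  by rewrite /two_sided_orbit iterSr SK.
Qed.

Lemma two_sided_orbit_conj h S Si S' Si' x n : cancel Si S -> cancel S' Si' ->
  (forall x, h (S x) = S' (h x)) ->
  h (two_sided_orbit S Si x n) = two_sided_orbit S' Si' (h x) n.
Proof.
move=> SiK SK' hS; have hSi z : h (Si z) = Si' (h z).
  by rewrite -{2}(SiK z) hS SK'.
by case: n => k /=; [elim: k => //= k <-|rewrite hSi; congr Si'; elim: k => //= k <-].
Qed.

Lemma two_sided_orbit_continuous S Si n : continuous S -> continuous Si ->
  continuous (fun x => two_sided_orbit S Si x n).
Proof.
move=> Sc Sic; have iterc f k : continuous f -> continuous (iter k f).
  move=> fc; elim: k => [|k IH]; first exact: continuous_id_fun.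
  exact: continuous_comp_fun IH fc.
by case: n => k; [exact: iterc|exact: (iterc _ k.+1)].
Qed.

Variables (T Ti : {linear X -> X}) (L : (int -> X) -> X) (K Mt Mi : R).
Hypotheses (TK : cancel T Ti) (TiK : cancel Ti T).
Hypotheses (Mt0 : 0 <= Mt) (Tb : forall x, rnorm (T x) <= Mt * rnorm x).
Hypotheses (Mi0 : 0 <= Mi) (Tib : forall x, rnorm (Ti x) <= Mi * rnorm x).
Hypothesis LP : green_operator T L K.

Let Tc : continuous T.
Proof. by apply: (lipschitz_continuous_fun Mt0) => x y; rewrite -linearB. Qed.

Let Tic : continuous Ti.
Proof. by apply: (lipschitz_continuous_fun Mi0) => x y; rewrite -linearB. Qed.

(** Only finitely many points of an orbit matter up to a given precision, and
    each of them depends continuously on the initial point. *)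
Lemma green_continuous (S Si g : X -> X) (r : R) :
  continuous S -> continuous Si -> continuous g -> (forall x, rnorm (g x) <= r) ->
  continuous (fun x => L (fun n => g (two_sided_orbit S Si x n))).
Proof.
have [_ _ Lsub _ Lc] := LP.
move=> Sc Sic gc gr; apply/continuous_rnormP => x e e0.
have e2 : 0 < e / 2 by rewrite divr_gt0.
have [N [d d0 Nd]] := Lc (r + r) _ e2.
have nearN (m : nat) : exists2 b, 0 < b & forall y, rnorm (x - y) < b ->
    forall n, (`|n| < m)%N ->
    rnorm (g (two_sided_orbit S Si x n) - g (two_sided_orbit S Si y n)) <= d.
  have near1 n : exists2 b, 0 < b & forall y, rnorm (x - y) < b ->
      rnorm (g (two_sided_orbit S Si x n) - g (two_sided_orbit S Si y n)) < d.
    have := continuous_comp_fun (@two_sided_orbit_continuous S Si n Sc Sic) gc.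
    by move/continuous_rnormP => /(_ x d d0).
  elim: m => [|m [b b0 bP]]; first by exists 1.
  have [b1 b10 b1P] := near1 m%:Z; have [b2 b20 b2P] := near1 (- m%:Z).
  exists (Num.min b (Num.min b1 b2)); first by rewrite !lt_min b0 b10.
  move=> y; rewrite !lt_min => /and3P[yb yb1 yb2] n; rewrite ltnS leq_eqVlt.
  case/predU1P => [nm|]; last exact: bP.
  have [->|->] : n = m%:Z \/ n = - m%:Z by clear -nm; lia.
    by rewrite ltW ?b1P.
  by rewrite ltW ?b2P.
have [b b0 bP] := nearN N.+1; exists b => // y xy.
rewrite -(Lsub r); [|by move=> n|by move=> n].
apply: le_lt_trans (_ : e / 2 < _); last by rewrite ltr_pdivrMr// ltr_pMr// ltr1n.
apply: Nd => [n|n nN]; last exact: bP.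
by apply: le_trans (rnormD _ _) _; rewrite rnormN lerD.
Qed.

(** The conjugacy [h] from [T + alpha] to [T] is an explicit series, while its
    inverse [h'] needs a fixed point because [alpha] is evaluated along the orbits
    of [T + alpha] that it produces. Both [h'] and [h] being given by the same
    Green operator, the deviation [chi] of [h' \o h] from the identity is the
    image under that operator of differences of values of [alpha] at points at
    distance [chi]; the Lipschitz constant of [alpha] then makes the supremum of
    [chi] at most half of itself. *)
Theorem green_strongly_structurally_stable : strongly_structurally_stable T.
Proof.
have [K0 Lb Lsub Lshift Lc] := LP; move=> e e0.
(* With [d] the inverse of [s], the three estimates [K d <= e], [K d <= 1 / 2] and
   [Mi d <= 1 / 2] hold: the size of the conjugacy, the contraction rate on
   conjugacies, and the contraction rate for the inverse of [T + alpha]. *)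
pose c := K / e; have c0 : 0 <= c by rewrite divr_ge0 ?(ltW K0) ?(ltW e0).
pose s := 2 * (K + Mi) + c + 1; pose d := s^-1.
have [s0 cs Ks Mis] : [/\ 0 < s, c <= s, 2 * K <= s & 2 * Mi <= s].
  by rewrite /s; move: K0 Mi0 c0; split; lra.
have d0 : 0 < d by rewrite invr_gt0.
have ds b : b <= s -> b * d <= 1 by move=> bs; rewrite /d ler_pdivrMr// mul1r.
have Kd : K * d <= e.
  have -> : K * d = c * d * e by rewrite /c; field; rewrite !gt_eqF.
  by rewrite -[leRHS]mul1r ler_pM2r// ds.
have Kd2 : K * d <= 1 / 2 by have := ds _ Ks; lra.
have Mid2 : Mi * d <= 1 / 2 by have := ds _ Mis; lra.
exists d => // alpha _ /sup_normP ad /(lip_constP _ (ltW d0)) al.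
have ac : continuous alpha := lipschitz_continuous_fun (ltW d0) al.
pose S x := T x + alpha x.
have Sc : continuous S by exact: continuous_add_fun.
have half1 : 1 / 2 < 1 :> R by lra.
have half0 : 0 <= 1 / 2 :> R by lra.
have [Si [Sic SiE]] : exists f, continuous f /\ forall y, Ti (y - alpha (f y)) = f y.
  apply: (@picard _ _ (fun f y => Ti (y - alpha (f y))) Ti (Mi * d) (1 / 2)) => //.
  - move=> f fc; apply: (continuous_comp_fun _ Tic).
    apply: continuous_sub_fun continuous_id_fun _; exact: continuous_comp_fun ac.
  - move=> f g r fg x; rewrite -linearB/=; apply: le_trans (Tib _) _.
    rewrite opprB addrC addrA subrK.
    apply: le_trans (ler_wpM2l Mi0 (al _ _)) _; rewrite mulrA ler_pM ?rnorm_ge0//.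
      by rewrite mulr_ge0// ltW.
    by rewrite rnormB.
  - move=> x; rewrite -linearB/= addrC addKr; apply: le_trans (Tib _) _.
    by rewrite rnormN ler_wpM2l.
have SiK : cancel Si S.
  by move=> y; rewrite /S -{1}(SiE y) TiK subrK.
have SK : cancel S Si.
  move=> x; have SiSx : Si (S x) - x = Ti (alpha x - alpha (Si (S x))).
    rewrite -{1}(SiE (S x)) -{3}(TK x) -linearB/= {1}/S.
    by rewrite addrAC [T x + _]addrC addrK.
  have : rnorm (Si (S x) - x) <= 1 / 2 * rnorm (Si (S x) - x).
    rewrite {1}SiSx; apply: le_trans (Tib _) _.
    apply: le_trans (ler_wpM2l Mi0 (al _ _)) _.
    by rewrite mulrA rnormB ler_wpM2r ?rnorm_ge0.
  move=> half; apply/eqP; rewrite -subr_eq0; apply/eqP/rnorm_eq0.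
  by have := rnorm_ge0 (Si (S x) - x); lra.
have abnd (z : int -> X) : bounded_by d (fun n => alpha (z n)) by move=> n; exact: ad.
pose phi x := - L (fun n => alpha (two_sided_orbit S Si x n)).
pose h x := x + phi x.
have phib x : rnorm (phi x) <= K * d by rewrite rnormN; exact: Lb.
have phic : continuous phi.
  move=> x; apply: cvgN; exact: (green_continuous Sc Sic ac ad).
have hT x : h (S x) = T (h x).
  have phiS : phi (S x) = T (phi x) - alpha x.
    rewrite /phi linearN -opprD; congr (- _).
    rewrite -[alpha x in RHS]/((fun n => alpha (two_sided_orbit S Si x n)) 0).
    rewrite -(Lshift d) ?abnd//; congr L; apply/funext => n.
    by rewrite two_sided_orbit_shift.
  by rewrite /h phiS (linearD T)/= /S addrACA subrr addr0.
have [psi [psic psiE]] : exists f, continuous f /\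
    forall y,
      L (fun n => alpha (two_sided_orbit T Ti y n + f (two_sided_orbit T Ti y n))) = f y.
  apply: (@picard _ _
    (fun f y =>
      L (fun n => alpha (two_sided_orbit T Ti y n + f (two_sided_orbit T Ti y n))))
    (fun=> 0) (K * d) (1 / 2)) => //.
  - by move=> x; exact: cvg_cst.
  - move=> f fc.
    apply: (green_continuous (g := fun y => alpha (y + f y)) Tc Tic _ (fun y => ad _)).
    apply: (continuous_comp_fun _ ac).
    exact: continuous_add_fun continuous_id_fun fc.
  - move=> f g r fg y; rewrite -(Lsub d) ?abnd//.
    have r0 : 0 <= r by apply: le_trans (fg y); exact: rnorm_ge0.
    apply: le_trans (Lb (d * r) _ _) _; last by rewrite mulrA ler_wpM2r.
    move=> n; apply: le_trans (al _ _) _; rewrite ler_wpM2l ?(ltW d0)//.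
    by rewrite opprD addrACA subrr add0r; exact: fg.
  - by move=> y; rewrite subr0; exact: Lb.
pose h' y := y + psi y.
have psib y : rnorm (psi y) <= K * d by rewrite -psiE; exact: Lb.
have h'S y : h' (T y) = S (h' y).
  have psiT : psi (T y) = T (psi y) + alpha (h' y).
    rewrite -2!psiE.
    rewrite -[alpha (h' y)]/((fun n => alpha (h' (two_sided_orbit T Ti y n))) 0).
    rewrite -(Lshift d) ?abnd//; congr L; apply/funext => n.
    by rewrite two_sided_orbit_shift.
  by rewrite /h' psiT /S (linearD T)/= addrA.
have hK' : cancel h' h.
  move=> y; rewrite /h /phi.
  have -> : (fun n => alpha (two_sided_orbit S Si (h' y) n)) =
      (fun n => alpha (two_sided_orbit T Ti y n + psi (two_sided_orbit T Ti y n))).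
    by apply/funext => n; rewrite -(two_sided_orbit_conj _ _ TiK SK h'S).
  by rewrite psiE /h' addrK.
have h'K : cancel h h'.
  pose chi x := h' (h x) - x.
  have chiE x : chi x = L (fun n => alpha (h' (h (two_sided_orbit S Si x n))) -
                                    alpha (two_sided_orbit S Si x n)).
    rewrite (Lsub d) ?abnd// /chi {1}/h' -psiE.
    have -> : (fun n => alpha (two_sided_orbit T Ti (h x) n +
                               psi (two_sided_orbit T Ti (h x) n))) =
        (fun n => alpha (h' (h (two_sided_orbit S Si x n)))).
      by apply/funext => n; rewrite (two_sided_orbit_conj _ _ SiK TK hT).
    by rewrite addrC addrA [- x + _]addrC [h x]addrC addrK addrC.
  have chib k x : rnorm (chi x) <= (K * d + K * d) * (1 / 2) ^+ k.
    elim: k x => [|k IH] x.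
      rewrite expr0 mulr1 /chi /h' {1}/h addrAC [x + _]addrC addrK.
      by apply: le_trans (rnormD _ _) _; apply: lerD.
    rewrite chiE; apply: le_trans (Lb (d * ((K * d + K * d) * (1 / 2) ^+ k)) _ _) _.
      move=> n; apply: le_trans (al _ _) _; rewrite ler_wpM2l ?(ltW d0)//.
      exact: IH.
    rewrite exprS mulrA [leRHS]mulrCA ler_wpM2r// mulr_ge0 ?exprn_ge0//.
    by rewrite addr_ge0// mulr_ge0// ltW.
  move=> x; apply/eqP; rewrite -subr_eq0; apply/eqP.
  by apply: (@rnorm_geometric_eq0 _ _ (1 / 2) (K * d + K * d)) => // k; exact: chib.
exists phi; split.
- by apply/sup_normP => x; exact: le_trans (phib x) Kd.
- split; first exact: continuous_add_fun continuous_id_fun phic.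
  by exists h'; split=> //; exact: continuous_add_fun continuous_id_fun psic.
- by apply/funext => x /=; rewrite -[RHS]/(h (S x)) hT.
Qed.

End Stability.

(** * Banach spaces of two-sided sequences *)

Section CoordinateSpace.
Variables (R : realType) (X : completeNormedModType R[i]).
Variable ev : X -> int -> R[i].
Implicit Types (x y : X) (n d : int).

(** What the spaces of p-summable and of vanishing sequences have in common: the
    norm dominates coordinates, is monotone in their moduli and invariant under
    translation, and every unit sequence has norm at most [1]. *)
Definition sequence_space : Prop :=
  [/\ forall (a : R[i]) x y n, ev (a *: x + y) n = a * ev x n + ev y n,
   forall x n, rnorm (ev x n) <= rnorm x,
   injective ev,
   forall d (M : R) x (s : int -> R[i]), 0 <= M ->
     (forall n, rnorm (s n) <= M * rnorm (ev x (n + d))) ->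
     exists y, ev y = s /\ rnorm y <= M * rnorm x &
   forall k, exists x, rnorm x <= 1 /\ ev x = fun n => (n == k)%:R].

Hypothesis XP : sequence_space.

Let evP (a : R[i]) x y n : ev (a *: x + y) n = a * ev x n + ev y n.
Proof. by have [evP _ _ _ _] := XP. Qed.

Lemma evD x y n : ev (x + y) n = ev x n + ev y n.
Proof. by have := evP 1 x y n; rewrite scale1r mul1r. Qed.

Lemma ev0 n : ev 0 n = 0.
Proof. by apply: (addrI (ev 0 n)); rewrite -evD !addr0. Qed.

Lemma evZ (a : R[i]) x n : ev (a *: x) n = a * ev x n.
Proof. by rewrite -[a *: x]addr0 evP ev0 addr0. Qed.

Lemma evB x y n : ev (x - y) n = ev x n - ev y n.
Proof. by rewrite evD -scaleN1r evZ mulN1r. Qed.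

Lemma weighted_translation (u : int -> R) d (M : R) : (forall n, `|u n| <= M) ->
  exists W : {linear X -> X}, (forall x n, ev (W x) n = (u n)%:C%C * ev x (n + d)) /\
    forall x, rnorm (W x) <= M * rnorm x.
Proof.
move=> uM; have [_ _ ev_inj solid _] := XP.
have M0 : 0 <= M by apply: le_trans (uM 0).
have /choice[f fP] x : exists y, ev y = (fun n => (u n)%:C%C * ev x (n + d)) /\
    rnorm y <= M * rnorm x.
  apply: (solid d M x _ M0) => n; rewrite rnormM rnorm_real.
  by rewrite ler_wpM2r ?rnorm_ge0.
have fl : linear f.
  move=> a x y; apply: ev_inj; apply/funext => n.
  by rewrite evP !(fP _).1 evP mulrDr mulrCA.
pose F : {linear X -> X} := HB.pack f (GRing.isLinear.Build _ _ _ _ f fl).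
by exists F; split=> [x n|x]; [rewrite (fP x).1|exact: (fP x).2].
Qed.

Variables (w : int -> R) (m M : R).
Hypotheses (m0 : 0 < m) (mw : forall k, m <= w k) (wM : forall k, w k <= M).
Variable T : {linear X -> X}.
Hypothesis TE : forall x n, ev (T x) n = (w (n + 1))%:C%C * ev x (n + 1).

Let w0 k : 0 < w k. Proof. exact: lt_le_trans (mw k). Qed.

Let M0 : 0 < M. Proof. exact: lt_le_trans (wM 0). Qed.

Lemma shift_bounded x : rnorm (T x) <= M * rnorm x.
Proof.
have [_ _ ev_inj _ _] := XP.
have [|W [WE Wb]] := @weighted_translation (fun n => w (n + 1)) 1 M.
  by move=> n; rewrite gtr0_norm.
suff -> : T x = W x by [].
by apply: ev_inj; apply/funext => n; rewrite TE WE.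
Qed.

Lemma shift_inverse : exists Ti : {linear X -> X},
  [/\ cancel T Ti, cancel Ti T & forall x, rnorm (Ti x) <= m^-1 * rnorm x].
Proof.
have [_ _ ev_inj _ _] := XP.
have [|W [WE Wb]] := @weighted_translation (fun n => (w n)^-1) (- 1) m^-1.
  by move=> n; rewrite gtr0_norm ?invr_gt0// lef_pV2 ?posrE.
have wV n : (w n)%:C%C * ((w n)^-1)%:C%C = 1 by rewrite -rmorphM/= mulfV ?gt_eqF.
exists W; split=> // x; apply: ev_inj; apply/funext => n.
  by rewrite WE TE subrK mulrA [_%:C%C * _]mulrC wV mul1r.
by rewrite TE WE addrK mulrA wV mul1r.
Qed.

(** The operators [T^k P] and [T^(-k-1) Q] are weighted translations, so their
    norms are suprema of weight products, which the dichotomy bounds. *)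
Lemma dichotomy_green_operator (D : pred int) : dichotomy w D ->
  exists L K, green_operator T L K.
Proof.
move=> [C [q [C0 q0 q1 DC DC']]]; have [_ _ ev_inj _ _] := XP.
have P0 k (n : nat) := wprod_gt0 m0 mw k n.
pose u (k : nat) n : R := if D (n + k%:Z) then wprod w (n + 1) k else 0.
pose v (k : nat) n : R := if D (n - k.+1%:Z) then 0 else (wprod w (n - k%:Z) k.+1)^-1.
have Cq (k : nat) : 0 <= C * q ^+ k by rewrite mulr_ge0 ?exprn_ge0 ?ltW.
have /choice[U UP] (k : nat) : exists W : {linear X -> X},
    (forall x n, ev (W x) n = (u k n)%:C%C * ev x (n + k%:Z)) /\
    forall x, rnorm (W x) <= C * q ^+ k * rnorm x.
  apply: weighted_translation => n; rewrite /u.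
  by case: ifP => Dn; rewrite ?normr0// gtr0_norm// DC.
have /choice[V VP] (k : nat) : exists W : {linear X -> X},
    (forall x n, ev (W x) n = (v k n)%:C%C * ev x (n - k.+1%:Z)) /\
    forall x, rnorm (W x) <= C * q ^+ k * rnorm x.
  apply: weighted_translation => n; rewrite /v.
  case: ifPn => Dn; rewrite ?normr0// gtr0_norm ?invr_gt0//.
  have := DC' _ k.+1 Dn; have -> : n - k.+1%:Z + 1 = n - k%:Z by lia.
  move=> /le_trans; apply; rewrite ler_pM2l// exprS ler_piMl ?exprn_ge0 ?ltW//.
apply: (@green_operator_exists _ _ T U V C q M) => //; try exact: ltW.
- exact: shift_bounded.
- by move=> k; exact: (UP k).2.
- by move=> k; exact: (VP k).2.
- move=> k x; apply: ev_inj; apply/funext => n; rewrite TE !(UP _).1 mulrA -rmorphM/=.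
  have -> : n + k.+1%:Z = n + 1 + k%:Z by lia.
  congr (_%:C%C * _); rewrite /u; have -> : n + k.+1%:Z = n + 1 + k%:Z by lia.
  by case: ifP; rewrite ?mulr0// wprodS.
- move=> k x; apply: ev_inj; apply/funext => n; rewrite TE !(VP _).1 mulrA -rmorphM/=.
  have nE : n + 1 - k.+2%:Z = n - k.+1%:Z by lia.
  rewrite nE; congr (_%:C%C * _); rewrite /v nE.
  case: ifP; rewrite ?mulr0//; have -> : n + 1 - k.+1%:Z = n - k%:Z by lia.
  move=> _; rewrite [in LHS]wprodSr; have -> : n - k%:Z + k.+1%:Z = n + 1 by lia.
  by rewrite invfM mulrCA mulfV ?mulr1// gt_eqF.
- move=> x; apply: ev_inj; apply/funext => n; rewrite evD TE (UP _).1 (VP _).1.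
  have -> : n + 1 - 1%:Z = n by lia.
  rewrite addr0 mulrA -rmorphM/= -mulrDl -rmorphD/= /u /v.
  have -> : n + 1 - 1%:Z = n by lia.
  rewrite addr0 subr0 /wprod big_geq// big_nat1 addr0.
  by case: ifP => _; rewrite ?mulr0 ?addr0 ?add0r ?mulfV ?mul1r// gt_eqF.
Qed.

Lemma dichotomy_stable (D : pred int) : dichotomy w D ->
  strongly_structurally_stable T.
Proof.
move=> /dichotomy_green_operator[L [K LP]]; have [Ti [TK TiK Tib]] := shift_inverse.
apply: (green_strongly_structurally_stable TK TiK _ shift_bounded _ Tib LP).
  exact: ltW.
by rewrite invr_ge0 ltW.
Qed.

End CoordinateSpace.

(** * Stability forces bounded solutions on long windows *)

Section Necessity.
Variables (R : realType) (X : completeNormedModType R[i]).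
Variable ev : X -> int -> R[i].
Hypothesis XP : sequence_space ev.
Variables (w : int -> R) (m : R).
Hypotheses (m0 : 0 < m) (mw : forall k, m <= w k).
Variable T : {linear X -> X}.
Hypothesis TE : forall x n, ev (T x) n = (w (n + 1))%:C%C * ev x (n + 1).

Let w0 k : 0 < w k. Proof. exact: lt_le_trans (mw k). Qed.

Definition tent (r : R) (p x : X) : R := Num.max 0 (1 - rnorm (x - p) / r).

Lemma tent_ge0 r p x : 0 <= tent r p x.
Proof. by rewrite /tent le_max lexx. Qed.

Lemma tent_le1 r p x : 0 < r -> tent r p x <= 1.
Proof.
move=> r0; rewrite /tent ge_max ler01/= gerBl.
by rewrite divr_ge0 ?rnorm_ge0// ltW.
Qed.

Lemma tent_center r p : tent r p p = 1.
Proof. by rewrite /tent subrr rnorm0 mul0r subr0 max_r. Qed.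

Lemma tent_out r p x : 0 < r -> r <= rnorm (x - p) -> tent r p x = 0.
Proof. by move=> r0 rx; rewrite /tent max_l// subr_le0 ler_pdivlMr// mul1r. Qed.

Lemma tent_lipschitz r p x y : 0 < r ->
  `|tent r p x - tent r p y| <= rnorm (x - y) / r.
Proof.
move=> r0.
have one_side a b : tent r p a - tent r p b <= rnorm (a - b) / r.
  rewrite lerBlDr {1}/tent ge_max addr_ge0 ?tent_ge0 ?divr_ge0 ?rnorm_ge0 ?(ltW r0)//=.
  have : 1 - rnorm (b - p) / r <= tent r p b by rewrite /tent le_max lexx orbT.
  have : rnorm (b - p) / r <= rnorm (a - b) / r + rnorm (a - p) / r.
    rewrite -mulrDl ler_pM2r ?invr_gt0// (rnormB a b).
    exact: rnorm_triangle.
  lra.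
rewrite ler_norml one_side andbT lerNl opprB.
by apply: le_trans (one_side y x) _; rewrite rnormB.
Qed.

(** The supports of the tents are disjoint, which bounds the supremum by a single
    term; the Lipschitz constant is bounded by the sum of those of the [N] tents,
    and the radius at least [N] compensates for their number. The last point
    [p N] carries no tent and only has to avoid the others. *)
Lemma tent_perturbation (r d : R) (N : nat) (p e : nat -> X) :
  0 < r -> 0 <= d -> N%:R <= r -> (forall i, rnorm (e i) <= 1) ->
  (forall i j, (i <= N)%N -> (j < N)%N -> i != j -> 2 * r <= rnorm (p i - p j)) ->
  exists alpha : X -> X,
    [/\ forall x, rnorm (alpha x) <= d,
        forall x y, rnorm (alpha x - alpha y) <= d * rnorm (x - y) &
        forall i, (i < N)%N -> alpha (p i) = d%:C%C *: e i].
Proof.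
move=> r0 d0 Nr e1 sep.
pose alpha x := \sum_(i < N) (d * tent r (p i) x)%:C%C *: e i.
have rnZ (a : R) i : 0 <= a -> rnorm (a%:C%C *: e i) <= a.
  move=> a0; rewrite -lecR rnormE normrZ -!rnormE -rmorphM/= lecR.
  by rewrite rnorm_real ger0_norm// ler_piMr.
have alone (i : 'I_N) x : rnorm (x - p i) < r ->
    alpha x = (d * tent r (p i) x)%:C%C *: e i.
  move=> xi; rewrite /alpha (bigD1 i)//= big1 ?addr0// => j ji.
  rewrite tent_out ?mulr0 ?scale0r//.
  have := sep i j (ltnW (ltn_ord i)) (ltn_ord j); rewrite eq_sym => /(_ ji).
  have := rnorm_triangle x (p i) (p j); rewrite (rnormB (p i) x).
  by move: xi; lra.
exists alpha; split.
- move=> x; have [[i xi]|none] := pselect (exists i : 'I_N, rnorm (x - p i) < r).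
    rewrite (alone i x xi); apply: le_trans (rnZ _ _ _) _.
      by rewrite mulr_ge0 ?tent_ge0.
    by rewrite ler_piMr ?tent_le1.
  rewrite /alpha big1 ?rnorm0// => i _; rewrite tent_out ?mulr0 ?scale0r//.
  by rewrite leNgt; apply/negP => xi; apply: none; exists i.
- move=> x y; rewrite /alpha -sumrB.
  have tP i : rnorm ((d * tent r (p i) x)%:C%C *: e i - (d * tent r (p i) y)%:C%C *: e i)
      <= d * (rnorm (x - y) / r).
    rewrite -scalerBl -rmorphB/= -mulrBr.
    rewrite -lecR rnormE normrZ -!rnormE -rmorphM/= lecR rnorm_real normrM (ger0_norm d0).
    apply: le_trans (ler_piMr _ (e1 i)) _; first by rewrite mulr_ge0.
    by rewrite ler_wpM2l// tent_lipschitz.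
  apply: le_trans (rnorm_sum _ (fun i => (d * tent r (p i) x)%:C%C *: e i -
    (d * tent r (p i) y)%:C%C *: e i)) _.
  apply: le_trans (_ : \sum_(i < N) d * (rnorm (x - y) / r) <= _).
    by apply: ler_sum => i _; exact: tP.
  rewrite sumr_const card_ord -[leLHS]mulr_natr -mulrA ler_wpM2l//.
  by rewrite mulrAC -mulrA ler_piMr ?rnorm_ge0// ler_pdivrMr// mul1r.
- move=> i iN; rewrite (alone (Ordinal iN)) ?tent_center ?mulr1//.
  by rewrite subrr rnorm0.
Qed.

(** The number [d] does not depend on the window: this uniformity is what stability
    provides. The solution [b] is minus the coordinate of the displacement [phi]
    along the pseudo-orbit, so its bound [1] is the one imposed on [phi]. *)
Lemma window_solution : strongly_structurally_stable T ->
  exists d : R, [/\ 0 < d, d < 1 & forall (q : int) (N : nat), exists b : nat -> R,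
    (forall i, (i <= N)%N -> `|b i| <= 1) /\
    (forall i, (i < N)%N -> b i.+1 = w (q - i%:Z) * b i + d)].
Proof.
move=> /(_ 1 ltr01)[d' d'0 stab].
pose d := Num.min d' (1 / 2); exists d.
have d0 : 0 < d by rewrite lt_min d'0/=; lra.
have dd' : d <= d' by rewrite ge_min lexx.
split=> //; first by rewrite gt_min; apply/orP; right; lra.
move=> q N; have [_ ev_le ev_inj _ units] := XP.
have /choice[unit unitP] := units.
pose m1 := Num.min m 1.
have m10 : 0 < m1 by rewrite lt_min m0/=.
have m1w k : m1 <= w k by rewrite ge_min mw.
have m11 : m1 <= 1 by rewrite ge_min lexx orbT.
pose r : R := N.+1%:R; have r0 : 0 < r by rewrite ltr0n.
(* This initial value keeps the pseudo-orbit above [2 * r] on the whole window,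
   since each step multiplies it by at least [m1]. *)
pose c := 2 * r / m1 ^+ N.
have c0 : 0 < c by rewrite divr_gt0 ?exprn_gt0// mulr_gt0.
pose v := fix v (i : nat) : R :=
  if i is j.+1 then w (q - j%:Z) * v j + d else c.
have v_ge i : m1 ^+ i * c <= v i.
  elim: i => [|i IH]; first by rewrite expr0 mul1r.
  rewrite exprS -mulrA -[leLHS]addr0/=; apply: lerD; last exact: ltW.
  by apply: ler_pM => //; [exact: ltW|rewrite mulr_ge0 ?exprn_ge0 ?(ltW c0) ?(ltW m10)].
have v_large i : (i <= N)%N -> 2 * r <= v i.
  move=> iN; apply: le_trans (v_ge i); rewrite /c mulrCA -[leLHS]mulr1.
  rewrite ler_pM2l ?mulr_gt0// ler_pdivlMr ?exprn_gt0// mul1r.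
  by rewrite ler_wiXn2l// ltW.
pose p i := (v i)%:C%C *: unit (q - i%:Z).
have evp i n : ev (p i) n = (v i)%:C%C * (n == q - i%:Z)%:R.
  by rewrite /p (evZ XP) (unitP _).2.
have sep i j : (i <= N)%N -> (j < N)%N -> i != j -> 2 * r <= rnorm (p i - p j).
  move=> iN jN ij; apply: le_trans (ev_le _ (q - i%:Z)).
  rewrite (evB XP) !evp eqxx mulr1.
  have -> : (q - i%:Z == q - j%:Z) = false.
    by clear -ij; apply/negbTE; move: ij; apply: contra => /eqP; lia.
  rewrite mulr0 subr0 rnorm_real; apply: le_trans (v_large i iN) _.
  exact: ler_norm.
have Nr : N%:R <= r by rewrite ler_nat.
have [alpha [ad al alphaE]] :=
  tent_perturbation r0 (ltW d0) Nr (fun i => (unitP (q - i.+1%:Z)).1) sep.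
have Tp i : (i < N)%N -> T (p i) + alpha (p i) = p i.+1.
  move=> iN; apply: ev_inj; apply/funext => n.
  rewrite alphaE// (evD XP) TE !evp (evZ XP) (unitP _).2.
  have -> : (n + 1 == q - i%:Z) = (n == q - i.+1%:Z) by clear; apply/eqP/eqP; lia.
  case: eqP => [->|_]; last by rewrite !mulr0 addr0.
  have -> : q - i.+1%:Z + 1 = q - i%:Z by clear; lia.
  by rewrite !mulr1 -rmorphM -rmorphD.
have [|||phi [/sup_normP phi1 _ conj]] := stab alpha.
- have PF : ProperFilter (globally ([set: X] `*` [set: X])).
    by apply: (@globally_properfilter _ _ (0, 0)).
  apply: (@klipschitzW _ _ _ d%:C%C) => -[x y] _ /=.
  by rewrite -!rnormE -rmorphM/= lecR; exact: al.
- by apply/sup_normP => x; exact: le_trans dd'.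
- apply/lip_constP; first exact: ltW.
  by move=> x y; apply: le_trans (al x y) _; rewrite ler_wpM2r ?rnorm_ge0.
exists (fun i => - complex.Re (ev (phi (p i)) (q - i%:Z))); split=> [i iN|i iN].
  rewrite normrN; apply: le_trans (Re_le_rnorm _) _.
  exact: le_trans (ev_le _ _) (phi1 _).
have := congr1 (fun f : X -> X => f (p i)) conj; rewrite /= Tp//.
move=> /(congr1 (fun x => complex.Re (ev x (q - i.+1%:Z)))).
rewrite TE (evD XP) !evp (evD XP) evp eqxx.
have -> : q - i.+1%:Z + 1 = q - i%:Z by clear; lia.
rewrite eqxx !mulr1.
set a := ev (phi (p i)) _; set b := ev (phi (p i.+1)) _.
have -> : complex.Re ((w (q - i%:Z))%:C%C * ((v i)%:C%C + a)) =
    w (q - i%:Z) * (v i + complex.Re a).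
  by case: a => a1 a2 /=; rewrite mul0r subr0.
have -> : complex.Re ((v i.+1)%:C%C + b) = v i.+1 + complex.Re b by case: b.
by rewrite /=; lra.
Qed.

End Necessity.

(** * From bounded solutions on windows to a dichotomy *)

Section WindowDichotomy.
Variables (R : realType) (w : int -> R) (m M : R).
Hypotheses (m0 : 0 < m) (mw : forall k, m <= w k) (wM : forall k, w k <= M).

Let w0 k : 0 < w k. Proof. exact: lt_le_trans (mw k). Qed.

Let M0 : 0 < M. Proof. exact: lt_le_trans (wM 0). Qed.

Let P0 k n : 0 < wprod w k n. Proof. exact: wprod_gt0 m0 mw k n. Qed.

Section Window.
Variables (d : R) (q : int) (N : nat) (b : nat -> R).
Hypotheses (d0 : 0 < d) (d1 : d < 1).
Hypothesis b1 : forall i, (i <= N)%N -> `|b i| <= 1.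
Hypothesis bS : forall i, (i < N)%N -> b i.+1 = w (q - i%:Z) * b i + d.

Lemma solution_ge0_mono i j : (i < j)%N -> (j <= N)%N -> 0 <= b i -> d <= b j.
Proof.
move=> + + bi; elim: j => // j IH; rewrite ltnS leq_eqVlt => ij jN.
rewrite bS// lerDr mulr_ge0 ?(ltW (w0 _))//.
case/predU1P: ij => [<-//|ij]; apply: le_trans (ltW d0) (IH ij _).
exact: ltnW.
Qed.

(** After a nonnegative value, [b] takes its values in [[d, 1]], and
    [w * b = b' - d <= (1 - d) * b'] for consecutive values [b] and [b']. *)
Lemma solution_ge0_contracts i j n : (i < j)%N -> (j + n <= N)%N -> 0 <= b i ->
  wprod w (q - (j + n)%:Z + 1) n <= d^-1 * (1 - d) ^+ n.
Proof.
move=> ij jnN bi; have d1' : 0 <= 1 - d by rewrite subr_ge0 ltW.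
have bj : d <= b j by apply: solution_ge0_mono ij _ bi; lia.
have : wprod w (q - (j + n)%:Z + 1) n * b j <= (1 - d) ^+ n * b (j + n)%N.
  elim: n jnN => [|n IH] jnN; first by rewrite addn0 /wprod big_geq// mul1r expr0 mul1r.
  have jn : (j + n <= N)%N by lia.
  rewrite wprodS; have -> : q - (j + n.+1)%N%:Z + 1 = q - (j + n)%N%:Z by lia.
  rewrite -mulrA; apply: le_trans (ler_wpM2l (ltW (w0 _)) (IH jn)) _.
  rewrite exprSr -mulrA mulrCA ler_wpM2l ?exprn_ge0// addnS.
  have : b (j + n).+1 <= 1 by apply: le_trans (ler_norm _) (b1 _); lia.
  rewrite bS; last by lia.
  set t := w _ * _ => t1; have := mulr_ge0 (ltW d0) (_ : 0 <= 1 - (t + d)).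
  by rewrite subr_ge0 => /(_ t1); lra.
have bn : b (j + n)%N <= 1 by apply: le_trans (ler_norm _) (b1 _).
move=> H; rewrite mulrC ler_pdivlMr//.
apply: le_trans (_ : wprod w (q - (j + n)%N%:Z + 1) n * b j <= _).
  by rewrite ler_pM2l.
by apply: le_trans H _; rewrite ler_piMr ?exprn_ge0.
Qed.

(** Before a negative value, [c := - b] is positive and at most [1], and
    [w * c = c' + d >= (1 + d) * c'] for consecutive values [c] and [c']. At the
    last step this equality also bounds [c] from below by [d / M]. *)
Lemma solution_lt0_expands i j n : (j + n < i)%N -> (i <= N)%N -> b i < 0 ->
  (wprod w (q - (j + n)%:Z + 1) n)^-1 <= M / d * (1 + d)^-1 ^+ n.
Proof.
move=> jni iN bi.
have neg l : (l <= i)%N -> b l < 0.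
  rewrite leq_eqVlt => /predU1P[->//|li]; rewrite ltNge; apply/negP => bl.
  by have := lt_le_trans d0 (solution_ge0_mono li iN bl); rewrite ltNge ltW.
have low l : (l <= i)%N -> - b l <= 1.
  by move=> li; apply: le_trans (b1 (_ : (l <= N)%N)); [rewrite -normrN ler_norm|lia].
have d1' : 0 < 1 + d by rewrite addr_gt0.
have : (1 + d) ^+ n * - b (j + n)%N <= wprod w (q - (j + n)%:Z + 1) n * - b j.
  elim: n jni => [|n IH] jni; first by rewrite addn0 /wprod big_geq// mul1r expr0 mul1r.
  have jn : (j + n < i)%N by lia.
  rewrite wprodS; have -> : q - (j + n.+1)%N%:Z + 1 = q - (j + n)%N%:Z by lia.
  rewrite -mulrA; apply: le_trans (ler_wpM2l (ltW (w0 _)) (IH jn)).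
  rewrite exprSr -mulrA [leRHS]mulrCA ler_wpM2l ?exprn_ge0 ?(ltW d1')// addnS.
  have := low (j + n).+1 jn; rewrite !mulrN bS; last by lia.
  set t := w _ * _ => t1; have := mulr_ge0 (ltW d0) (_ : 0 <= 1 + (t + d)).
  have -> : 0 <= 1 + (t + d) by rewrite -lerBlDr sub0r.
  by move=> /(_ isT); lra.
have bjn : d / M <= - b (j + n)%N.
  rewrite ler_pdivrMr//; have := neg (j + n).+1 jni; rewrite bS; last by lia.
  have := wM (q - (j + n)%:Z); have := neg (j + n)%N (ltnW jni); nra.
have bj : - b j <= 1 by apply: low; lia.
move=> H; have {}H : (1 + d) ^+ n * (d / M) <= wprod w (q - (j + n)%:Z + 1) n.
  apply: le_trans (ler_wpM2l _ bjn) _; first by rewrite exprn_ge0// ltW.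
  by apply: le_trans H _; rewrite ler_piMr// ltW.
have -> : M / d * (1 + d)^-1 ^+ n = ((1 + d) ^+ n * (d / M))^-1.
  by rewrite exprVn invfM invf_div mulrC.
by rewrite lef_pV2 ?posrE ?mulr_gt0 ?exprn_gt0 ?invr_gt0.
Qed.

End Window.

(** A decay estimate for the intervals at distance [P] from the origin extends to
    the whole half-line: an interval contains at most [P] of the other positions,
    and each of those costs a factor at most [B / q]. *)
Section BoundedGap.
Variables (u : int -> R) (B C q : R) (P : nat).
Hypotheses (u0 : forall k, 0 < u k) (uB : forall k, u k <= B) (B1 : 1 <= B).
Hypotheses (C0 : 0 < C) (q0 : 0 < q) (q1 : q < 1).

Definition gap_const : R := (C + 1) * (B / q) ^+ P.

Let B0 : 0 < B. Proof. exact: lt_le_trans B1. Qed.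

Let Bq1 : 1 <= B / q.
Proof. by rewrite ler_pdivlMr// mul1r; apply: le_trans B1; exact: ltW. Qed.

Lemma gap_const_gt0 : 0 < gap_const.
Proof. by rewrite mulr_gt0 ?addr_gt0// exprn_gt0// divr_gt0. Qed.

Lemma wprod_le k n : wprod u k n <= B ^+ n.
Proof.
rewrite -[X in B ^+ X]subn0 -prodr_const_nat; apply: ler_prod => j _.
by rewrite uB ltW.
Qed.

Let wprod_short k n : (n <= P)%N -> wprod u k n <= gap_const * q ^+ n.
Proof.
move=> nP; apply: le_trans (wprod_le _ _) _.
have -> : B ^+ n = (B / q) ^+ n * q ^+ n.
  by rewrite -exprMn divfK// gt_eqF.
rewrite ler_wpM2r ?exprn_ge0 ?(ltW q0)// /gap_const.
apply: le_trans (_ : (B / q) ^+ P <= _); first exact: ler_weXn2l.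
by rewrite ler_peMl ?lerDr ?(ltW C0)// exprn_ge0// divr_ge0// ltW.
Qed.

Let wprod_long x y n : (P <= n)%N -> 0 < x -> x <= C * q ^+ (n - P) ->
  0 < y -> y <= B ^+ P -> x * y <= gap_const * q ^+ n.
Proof.
move=> Pn x0 xC y0 yB; apply: le_trans (ler_pM (ltW x0) (ltW y0) xC yB) _.
have -> : B ^+ P = (B / q) ^+ P * q ^+ P by rewrite -exprMn divfK// gt_eqF.
have -> : C * q ^+ (n - P) * ((B / q) ^+ P * q ^+ P) = C * (B / q) ^+ P * q ^+ n.
  by rewrite -{2}(subnK Pn) exprD; ring.
rewrite ler_wpM2r ?exprn_ge0 ?(ltW q0)// /gap_const ler_wpM2r ?lerDl//.
by rewrite exprn_ge0// divr_ge0// ltW.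
Qed.

Let up0 k n : 0 < wprod u k n. Proof. by rewrite prodr_gt0. Qed.

Lemma decay_fill_left :
  (forall k n, k + n%:Z <= - P%:Z -> wprod u k n <= C * q ^+ n) ->
  forall k n, k + n%:Z <= 0 -> wprod u k n <= gap_const * q ^+ n.
Proof.
move=> H k n kn; have [nP|/ltnW Pn] := leqP n P; first exact: wprod_short.
rewrite -(subnK Pn) wprodD subnK//; apply: wprod_long => //; last exact: wprod_le.
by apply: H; lia.
Qed.

Lemma decay_fill_right :
  (forall k n, P%:Z <= k -> wprod u k n <= C * q ^+ n) ->
  forall k n, 0 <= k -> wprod u k n <= gap_const * q ^+ n.
Proof.
move=> H k n kn; have [nP|/ltnW Pn] := leqP n P; first exact: wprod_short.
rewrite -(subnKC Pn) wprodD subnKC// mulrC.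
by apply: wprod_long => //; [apply: H; lia|exact: wprod_le].
Qed.

End BoundedGap.

(** If the nonnegative part of the windows reaches arbitrarily far to the right,
    the shift contracts everywhere; if the negative part reaches arbitrarily far
    to the left, it expands everywhere. Otherwise the sign change stays in a
    bounded interval, and only the finitely many positions around the origin have
    to be accounted for. *)
Lemma bounded_windows_dichotomy (d : R) : 0 < d -> d < 1 ->
  (forall (q : int) (N : nat), exists b : nat -> R,
    (forall i, (i <= N)%N -> `|b i| <= 1) /\
    (forall i, (i < N)%N -> b i.+1 = w (q - i%:Z) * b i + d)) ->
  [\/ dichotomy w predT, dichotomy w pred0 | dichotomy w (fun k => k < 0)].
Proof.
move=> d0 d1 sol.
pose C := (1 + M) / d; pose L := (1 + d)^-1.
have C0 : 0 < C by rewrite divr_gt0 ?addr_gt0.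
have d1' : 0 < 1 + d by rewrite addr_gt0.
have L0 : 0 < L by rewrite invr_gt0.
have L1 : L < 1 by rewrite invf_lt1// ltrDl.
have CL c l n : 0 <= c -> c <= 1 + M -> 0 <= l -> l <= L ->
    c / d * l ^+ n <= C * L ^+ n.
  move=> c0 cM l0 lL; rewrite ler_pM ?divr_ge0 ?exprn_ge0 ?(ltW d0)//.
    by rewrite ler_pM2r ?invr_gt0.
  by rewrite lerXn2r// nnegrE// ltW.
(* [s N p] tells whether the solution on the window from [-N] to [N] is nonnegative
   at the position [p], that is at time [N - p]. *)
have /choice[s sP] (N : nat) : exists s : int -> bool, forall p, (`|p| <= N)%N ->
    (s p -> forall k n, - N%:Z < k -> k + n%:Z <= p -> wprod w k n <= C * L ^+ n) /\
    (~~ s p -> forall k n, p + 1 < k -> k + n%:Z <= N%:Z + 1 ->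
       (wprod w k n)^-1 <= C * L ^+ n).
  have [b [b1 bS]] := sol N%:Z (N + N)%N.
  exists (fun p => 0 <= b `|(N%:Z - p)%R|%N) => p pN; split=> bp k n.
    move=> kN knp.
    have := @solution_ge0_contracts d N%:Z (N + N)%N b d0 d1 b1 bS
      `|(N%:Z - p)%R|%N `|(N%:Z - k - n%:Z + 1)%R|%N n _ _ bp.
    have -> : (`|(N%:Z - p)%R| < `|(N%:Z - k - n%:Z + 1)%R|)%N by clear -pN kN knp; lia.
    have -> : (`|(N%:Z - k - n%:Z + 1)%R| + n <= N + N)%N by clear -pN kN knp; lia.
    have -> : N%:Z - (`|(N%:Z - k - n%:Z + 1)%R| + n)%N%:Z + 1 = k by clear -pN kN knp; lia.
    move=> /(_ isT isT)/le_trans; apply; rewrite -[d^-1]mul1r; apply: CL => //.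
    - by rewrite lerDl ltW.
    - by rewrite subr_ge0 ltW.
    - rewrite /L -div1r ler_pdivlMr//.
      have -> : (1 - d) * (1 + d) = 1 - d * d by ring.
      by rewrite gerBl mulr_ge0// ltW.
  rewrite -ltNge in bp; move=> kp knN.
  have := @solution_lt0_expands d N%:Z (N + N)%N b d0 d1 b1 bS
    `|(N%:Z - p)%R|%N `|(N%:Z - k - n%:Z + 1)%R|%N n _ _ bp.
  have -> : (`|(N%:Z - k - n%:Z + 1)%R| + n < `|(N%:Z - p)%R|)%N by clear -pN kp knN; lia.
  have -> : (`|(N%:Z - p)%R| <= N + N)%N by clear -pN kp knN; lia.
  have -> : N%:Z - (`|(N%:Z - k - n%:Z + 1)%R| + n)%N%:Z + 1 = k by clear -pN kp knN; lia.
  move=> /(_ isT isT)/le_trans; apply; apply: CL => //.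
  - exact: ltW.
  - by rewrite lerDr.
  - exact: ltW.
have [HA|] := pselect (forall P : nat, exists2 N, (P <= N)%N & s N P%:Z).
  apply: Or31; exists C, L; split=> // k n _.
  have [N PN sN] := HA (`|k| + n + 1)%N.
  by apply: ((sP N _ _).1 sN); clear -PN; lia.
move=> /existsNP[P1 nP1].
have {}nP1 N : (P1 <= N)%N -> ~~ s N P1%:Z.
  by move=> PN; apply/negP => sN; apply: nP1; exists N.
have [HB|] := pselect (forall P : nat, exists2 N, (P <= N)%N & ~~ s N (- P%:Z)).
  apply: Or32; exists C, L; split=> // k n _.
  have [N PN sN] := HB (`|k| + n + 2)%N.
  by apply: ((sP N _ _).2 sN); clear -PN; lia.
move=> /existsNP[P2 nP2].
have {}nP2 N : (P2 <= N)%N -> s N (- P2%:Z).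
  by move=> PN; apply/negPn/negP => sN; apply: nP2; exists N.
pose P := (P1 + P2 + 2)%N; pose B := Num.max 1 (Num.max M m^-1).
have B1 : 1 <= B by rewrite le_max lexx.
have wB k : w k <= B by rewrite !le_max wM orbT.
have wVB k : (w k)^-1 <= B by rewrite !le_max lef_pV2 ?posrE// mw !orbT.
apply: Or33; exists (gap_const B C L P), L.
have left k n : k + n%:Z <= - P%:Z -> wprod w k n <= C * L ^+ n.
  move=> kn; have sN := nP2 (P + `|k|)%N ltac:(clear; lia).
  by apply: ((sP _ _ _).1 sN); clear -kn; lia.
have right k n : P%:Z <= k -> wprod (fun j => (w j)^-1) k n <= C * L ^+ n.
  move=> kP; have sN := nP1 (P + `|k| + n)%N ltac:(clear; lia).
  by rewrite wprodV; apply: ((sP _ _ _).2 sN); clear -kP; lia.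
split=> //; first exact: gap_const_gt0.
- by move=> k n kn; apply: decay_fill_left left _ _ _ => //; clear -kn; lia.
- move=> k n kn; rewrite -wprodV.
  apply: decay_fill_right right _ _ _ => //; last by clear -kn; lia.
  by move=> j; rewrite invr_gt0.
Qed.

End WindowDichotomy.

(** * The weighted shifts *)

Lemma sequence_space_shift_stable (R : realType) (X : completeNormedModType R[i])
    (ev : X -> int -> R[i]) (w : int -> R) (m M : R) (T : {linear X -> X}) :
  sequence_space ev -> 0 < m -> (forall k, m <= w k) -> (forall k, w k <= M) ->
  (forall x n, ev (T x) n = (w (n + 1))%:C%C * ev x (n + 1)) ->
  strongly_structurally_stable T <->
  [\/ condition_A w, condition_B w | condition_C w].
Proof.
move=> XP m0 mw wM TE.
have [AE BE CE] := And3 (condition_AE m0 mw wM) (condition_BE m0 mw wM)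
  (condition_CE m0 mw wM).
split=> [/(window_solution XP m0 mw TE)[d [d0 d1 sol]]|].
  have [/AE|/BE|/CE] := bounded_windows_dichotomy m0 mw wM d0 d1 sol.
  - exact: Or31.
  - exact: Or32.
  - exact: Or33.
by case=> [/AE|/BE|/CE]; exact: (dichotomy_stable XP m0 mw wM TE).
Qed.

Lemma lp_sequence_space (R : realType) (p : R) (p1 : 1 <= p) :
  sequence_space (@lp_val R p p1).
Proof.
have p0 : 0 < p by apply: lt_le_trans p1.
split=> //.
- move=> x n; apply: (@lp_coord _ _ p1 x) (rnorm_ge0 _) _.
  by rewrite -lp_rnorm_le ?rnorm_ge0.
- exact: val_inj.
- move=> d M x s M0 sM.
  have bij : set_bij [set: int] [set: int] (fun n : int => n + d).
    split=> // [a b _ _|n _]; first exact: addIr.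
    by exists (n - d) => //; rewrite subrK.
  have sx : (lp_sum p s <= (M `^ p)%:E * lp_sum p (lp_val x))%E.
    have -> : lp_sum p (lp_val x) = lp_sum p (fun n => lp_val x (n + d)).
      by rewrite /lp_sum /psum (reindex_esum _ _ _ _ bij).
    rewrite /lp_sum -psumZ//; last by move=> n; exact: rnorm_ge0.
    by apply: (psum_le p1) => n; rewrite rnorm_ge0 sM.
  have sp : s \in lp_pred p1.
    apply/lp_predP; apply: le_lt_trans sx _.
    by rewrite lte_mul_pinfty ?lee_fin ?powR_ge0// lp_valP.
  exists (LpSeq sp); split=> //.
  rewrite lp_rnorm_le ?mulr_ge0 ?rnorm_ge0//; apply: le_trans sx _.
  rewrite powRM ?rnorm_ge0// EFinM lee_wpmul2l ?lee_fin ?powR_ge0//.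
  by rewrite -lp_rnorm_le ?rnorm_ge0.
- move=> k; pose s : int -> R[i] := fun n => (n == k)%:R.
  have s1 : lp_sum p s = 1%E.
    rewrite /lp_sum /psum (_ : (fun _ => _) = fun n => if n \in [set k] then 1%E else 0%E).
      by rewrite -esum_mkcond esum_set1.
    apply/funext => n; rewrite /s.
    have -> : (n \in [set k]) = (n == k) by apply/idP/eqP; rewrite inE.
    case: eqP => _; first by rewrite /rnorm normr1/= powR1.
    by rewrite rnorm0 powR0 ?gt_eqF.
  have sp : s \in lp_pred p1 by apply/lp_predP; rewrite s1 ltry.
  exists (LpSeq sp); split=> //.
  by rewrite lp_rnorm_le// powR1 s1.
Qed.

Lemma c0_sequence_space (R : realType) : sequence_space (@c0_val R).
Proof.
split=> //.
- by move=> x n; rewrite c0_rnormE; exact: c0_norm_ge (c0_valP x).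
- exact: val_inj.
- move=> d M x s M0 sM.
  have sc : s \in @c0_pred R.
    apply/c0_predP => e e0; have M1 : 0 < M + 1 by rewrite ltr_wpDl.
    have /c0_predP/(_ _ (divr_gt0 e0 M1))[K KP] := c0_valP x.
    exists (K + `|d|)%N => n Kn; apply: le_lt_trans (sM n) _.
    have := KP (n + d) ltac:(lia); rewrite ltr_pdivlMr// mulrC; apply: le_lt_trans.
    by rewrite ler_wpM2r ?rnorm_ge0// lerDl.
  exists (C0Seq sc); split=> //; rewrite !c0_rnormE.
  apply/c0_norm_leP => // n; apply: le_trans (sM n) _.
  by rewrite ler_wpM2l//; exact: c0_norm_ge (c0_valP x).
- move=> k; pose s : int -> R[i] := fun n => (n == k)%:R.
  have sc : s \in @c0_pred R.
    apply/c0_predP => e e0; exists `|k|.+1 => n kn; rewrite /s.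
    have -> : (n == k) = false by apply/eqP => nk; move: kn; rewrite nk ltnn.
    by rewrite rnorm0.
  exists (C0Seq sc); split=> //; rewrite c0_rnormE; apply/c0_norm_leP => // n.
  by rewrite /= /s; case: eqP => _; rewrite ?rnorm0// /rnorm normr1.
Qed.

Theorem theorem1p1 (R : realType) (w : int -> R)
  (w_gt0 : forall n : int, 0 < w n)
  (w_inf : 0 < inf (range w)) (w_ub : has_ubound (range w)) :
  (forall (p : R) (p1 : 1 <= p),
     strongly_structurally_stable (lp_shift (p1 := p1) w_gt0 w_ub) <->
     [\/ condition_A w, condition_B w | condition_C w]) /\
  (strongly_structurally_stable (c0_shift w_gt0 w_ub) <->
   [\/ condition_A w, condition_B w | condition_C w]).
Proof.
have w_lb : has_lbound (range w) by exists 0 => _ [n _ <-]; exact: ltW.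
have mw k : inf (range w) <= w k by apply: ge_inf => //; exists k.
have wM k : w k <= sup (range w) by apply: ub_le_sup => //; exists k.
split=> [p p1|].
  exact: (sequence_space_shift_stable (lp_sequence_space p1) w_inf mw wM).
exact: (sequence_space_shift_stable (c0_sequence_space R) w_inf mw wM).
Qed.
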